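(* For every integer $d\geq 5$ there exist constants $c>0$ and $n_0$ such that for all $n\geq n_0$, $$\mathrm{sn}(d,n)\;\geq\; 2^{\,c\, n^{\lfloor (d-1)/2\rfloor}},$$ where $\mathrm{sn}(d,n)$ denotes the number of distinct $\lfloor d/2\rfloor$-neighborly simplicial $(d-1)$-spheres with vertex set $[n]=\{1,\dots,n\}$ (labeled vertices). That is, $\mathrm{sn}(d,n)\geq 2^{\Omega(n^{\lfloor (d-1)/2\rfloor})}$.
   Context: A simplicial complex $\Delta$ with vertex set $V$ is $i$-neighborly (w.r.t. $V$) if every subset of $V$ of size at most $i$ is a face of $\Delta$. A simplicial $(d-1)$-sphere is a simplicial complex homeomorphic to the $(d-1)$-sphere; two such spheres on vertex set $[n]$ are counted as distinct if their sets of faces differ. *)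

(* Defs.v *)
From HB Require Import structures.
From mathcomp Require Import all_boot all_order all_algebra.
From mathcomp Require Import all_classical all_reals all_analysis.
Set Implicit Arguments. Unset Strict Implicit. Unset Printing Implicit Defensive.
Import Order.TTheory GRing.Theory Num.Theory.
Import numFieldNormedType.Exports.
Local Open Scope classical_set_scope.
Local Open Scope ring_scope.

Definition simplicial_complex (n : nat) (D : {set {set 'I_n}}) : Prop :=
  (finset.set0 : {set 'I_n}) \in D /\ forall F G : {set 'I_n}, F \in D -> G \subset F -> G \in D.

Definition neighborly (n i : nat) (D : {set {set 'I_n}}) : Prop :=
  forall F : {set 'I_n}, (#|F| <= i)%N -> F \in D.

(* Geometric realization of D inside R^n: union of the closed simplices
   conv{e_v : v in F}, F in D (points of the standard simplex whose support is
   a face). *)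
Definition geom_realization (R : realType) (n : nat) (D : {set {set 'I_n}})
  : set 'rV[R]_n :=
  [set x | (forall i, 0 <= x ord0 i) /\ \sum_i x ord0 i = 1 /\
           (finset [pred i : 'I_n | x ord0 i != 0]) \in D].

Definition unit_sphere (R : realType) (m : nat) : set 'rV[R]_m :=
  [set y | \sum_i (y ord0 i) ^+ 2 = 1].

Definition homeomorphic (R : realType) (n m : nat)
  (A : set 'rV[R]_n) (B : set 'rV[R]_m) : Prop :=
  exists (f : 'rV[R]_n -> 'rV[R]_m) (g : 'rV[R]_m -> 'rV[R]_n),
    (forall x, A x -> B (f x)) /\
    (forall y, B y -> A (g y)) /\
    (forall x, A x -> g (f x) = x) /\
    (forall y, B y -> f (g y) = y) /\
    {within A, continuous f} /\
    {within B, continuous g}.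

Definition simplicial_sphere (R : realType) (d n : nat) (D : {set {set 'I_n}})
  : Prop :=
  simplicial_complex D /\ homeomorphic (@geom_realization R n D) (@unit_sphere R d).

Definition sn (R : realType) (d n : nat) : nat :=
  #|[set D : {set {set 'I_n}} |
      `[< @simplicial_sphere R d n D /\ @neighborly n (d./2) D >]]|.

(* Main.v *)
(** All spheres below are obtained from the boundary of a simplex by bistellar
    flips, which preserve the homeomorphism type.  Write [m = (d+1)/2].  The
    cells are the unions of [m] disjoint pairs of consecutive integers (Gale's
    condition), ordered coordinatewise; a lower set [I] of cells is a squeezed
    ball in the sense of Kalai.

    If [d = 2m-1], add to [I] all cells containing the least vertex: the result
    is a shellable [d]-ball whose boundary is [(m-1)]-neighborly, and a maximal
    cell [F] belongs to [I] iff the set of upper elements of its pairs is a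
    face of that boundary.

    If [d = 2m], the cells form, inside the boundary of the cyclic
    [2m]-polytope, the complement of a few facets.  The relative squeezed ball
    [J \ I], where [J] consists of the cells containing the least vertex and of
    the translates [F+1] of [F] in [I], is replaced by the cone over its
    boundary from a new vertex [w].  Enlarging [I] by one cell [F] amounts to
    two flips: the first exchanges the [m]-set [p] of upper elements of [F]
    with [w + (p+1)], the second exchanges [w + (p-1)] with [p]; hence
    [m]-neighborliness survives.  Moreover [F] is a facet iff it lies in [I].

    Every subset of a level (an antichain) of cells yields a lower set, and some
    level has at least [c n^(m-1)] elements. *)

Require Import Defs.
From HB Require Import structures.
From mathcomp Require Import all_boot all_order all_algebra.
From mathcomp Require Import zify ring.
Set Implicit Arguments. Unset Strict Implicit. Unset Printing Implicit Defensive.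

(** * Bistellar flips *)

Section Flips.
Variables (T : finType) (d : nat).
Implicit Types (A B F G H r : {set T}) (Phi X : {set {set T}}).

Definition face Phi G := [exists F in Phi, G \subset F].

Definition ridges H : {set {set T}} := [set H :\ h | h in H].

(* Boundary modulo 2 of the chain of d-simplices X. *)
Definition bdry X : {set {set T}} :=
  [set r : {set T} | (#|r| == d) && odd #|[set H : {set T} in X | r \subset H]|].

Definition adj Phi G : rel {set T} := fun F F' =>
  [&& F \in Phi, F' \in Phi, G \subset F :&: F' & d <= #|F :&: F'|.+1].

(* Normal pseudomanifolds: the facets around every face G are connected through
   ridges containing G. *)
Record npm Phi : Prop := Npm {
  npm_card : forall F, F \in Phi -> #|F| = d;
  npm_ridge : forall r F1 F2 F3, #|r|.+1 = d ->
    F1 \in Phi -> F2 \in Phi -> F3 \in Phi ->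
    r \subset F1 -> r \subset F2 -> r \subset F3 ->
    [|| F1 == F2, F1 == F3 | F2 == F3];
  npm_conn : forall G F F', F \in Phi -> F' \in Phi ->
    G \subset F -> G \subset F' -> connect (adj Phi G) F F' }.

(** The join of [A] with the boundary of [B] is exchanged for the join of [B] with the boundary of
    [A]. *)
Definition flip Phi A B : {set {set T}} :=
  (Phi :\: [set (A :|: B) :\ b | b in B]) :|: [set (A :|: B) :\ a | a in A].

Lemma ridgesP H r : reflect (exists2 h, h \in H & r = H :\ h) (r \in ridges H).
Proof. exact: imsetP. Qed.

Lemma card_ridge H h : #|H| = d.+1 -> h \in H -> #|H :\ h| = d.
Proof. by rewrite (cardsD1 h) => + hH; rewrite hH => -[]. Qed.

Lemma faceP Phi G : reflect (exists2 F, F \in Phi & G \subset F) (face Phi G).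
Proof.
apply: (iffP existsP) => [[F /andP[FP GF]]|[F FP GF]]; exists F => //.
by rewrite FP.
Qed.

Lemma adj_sym Phi G : symmetric (adj Phi G).
Proof. by move=> F F'; rewrite /adj setIC andbCA. Qed.

Lemma npm_ridges H : #|H| = d.+1 -> npm (ridges H).
Proof.
move=> cH.
have crd h := card_ridge (h := h) cH.
split.
- by move=> F /ridgesP[h hH ->]; exact: crd.
- move=> r F1 F2 F3 cr /ridgesP[a aH ->] /ridgesP[b bH ->] /ridgesP[c cH' ->].
  move=> ra rb rc; apply/negPn/negP; rewrite !negb_or => /and3P[nab nac nbc].
  have ab : a != b by apply: contraNneq nab => ->.
  have ac : a != c by apply: contraNneq nac => ->.
  have bc : b != c by apply: contraNneq nbc => ->.
  have : r \subset H :\ a :\ b :\ c.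
    apply/subsetP => x xr; rewrite !inE.
    move: (subsetP ra _ xr) (subsetP rb _ xr) (subsetP rc _ xr); rewrite !inE.
    by move=> /andP[-> ->] /andP[-> _] /andP[-> _].
  move/subset_leq_card.
  have := crd _ aH; rewrite (cardsD1 b) !inE eq_sym ab bH /=.
  rewrite (cardsD1 c) !inE (eq_sym c) bc (eq_sym c) ac cH' /=; move: cr; clear; lia.
- move=> G F F' FP F'P GF GF'; apply: connect1; rewrite /adj FP F'P subsetI GF GF' /=.
  case/ridgesP: FP => a aH ->; case/ridgesP: F'P => b bH ->.
  have -> : (H :\ a) :&: (H :\ b) = H :\ a :\ b.
    by apply/setP => x; rewrite !inE; case: (x \in H) (x == a) (x == b) => [] [] [].
  by rewrite -(crd _ aH) (cardsD1 b (H :\ a)); case: (b \in _).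
Qed.

Section Flip.
Variables (Phi : {set {set T}}) (A B : {set T}).
Hypothesis nPhi : npm Phi.
Hypothesis AB0 : [disjoint A & B].
Hypothesis cAB : #|A :|: B| = d.+1.
Hypothesis B0 : B != set0.
Hypothesis oldP : forall b, b \in B -> (A :|: B) :\ b \in Phi.
Hypothesis newB : ~~ face Phi B.
Let H := A :|: B.

Let aNB a : a \in A -> a \notin B.
Proof. by move=> aA; rewrite (disjointFr AB0 aA). Qed.

Let crdH h : h \in H -> #|H :\ h| = d.
Proof. exact: card_ridge cAB. Qed.

Let oldN F : F \in Phi -> ~~ (B \subset F).
Proof.
by move=> FP; apply: contra newB => BF; apply/faceP; exists F.
Qed.

Let newP a : a \in A -> H :\ a \in [set H :\ a | a in A].
Proof. by move=> aA; apply/imsetP; exists a. Qed.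

(* Strong connectivity of the star of A, together with the ridge condition,
   forces the link of A to be exactly the boundary of the simplex B. *)
Lemma star_flip F : F \in Phi -> A \subset F -> exists2 b, b \in B & F = H :\ b.
Proof.
move=> FP AF.
have [b0 b0B] := set0Pn _ B0.
have sA b : b \in B -> A \subset H :\ b.
  move=> bB; apply/subsetP => x xA; rewrite !inE xA andbT.
  by apply: contraTneq bB => <-; exact: aNB.
have /connectP[p] := npm_conn nPhi (oldP b0B) FP (sA _ b0B) AF.
move: (b0B); elim: p b0 {b0B} => [|K p IH] b bB /=; first by move=> _ ->; exists b.
case/andP => /and4P[HP KP AI cI] pth eF.
suff [c cB eK] : exists2 c, c \in B & K = H :\ c.
  by apply: (IH c) => //; rewrite -?eK // -eK.
case: (eqVneq K (H :\ b)) => [->|nK]; first by exists b.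
have bH : b \in H by rewrite inE bB orbT.
(* The ridge [r] contains [A], so the vertex [c] of [H :\ b] that it misses lies in [B]. Then
   [H :\ b], [K] and [H :\ c] all pass through [r], and the ridge condition leaves only
   [K = H :\ c]. *)
set r := (H :\ b) :&: K.
have cr : #|r|.+1 = d.
  have cK := npm_card nPhi KP.
  have : r \proper K.
    rewrite properEneq subsetIr andbT; apply: contra nK => /eqP rK.
    by rewrite eqEcard (npm_card nPhi HP) cK leqnn andbT -rK subsetIl.
  by move/proper_card; rewrite cK => lt; apply/eqP; rewrite eqn_leq lt.
have : r \proper H :\ b by rewrite properEcard subsetIl crdH // -cr ltnSn.
case/properP => _ [c cHb cr'].
have cH : c \in H by move: cHb; rewrite !inE => /andP[].
have cB : c \in B.
  move: cH; rewrite !inE => /orP[cA|//]; case/negP: cr'.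
  by move/subsetP: AI => /(_ _ cA).
have ncb : c != b by move: cHb; rewrite !inE => /andP[].
exists c => //.
have rc : r \subset H :\ c.
  apply/subsetP => x xr; rewrite !inE; apply/andP; split.
    by apply: contraNneq cr' => <-.
  by move: xr; rewrite !inE => /andP[/andP[_ ->]].
have := npm_ridge nPhi cr HP KP (oldP cB) (subsetIl _ _) (subsetIr _ _) rc.
rewrite eq_sym (negPf nK) /= => /orP[/eqP/setP/(_ b)|/eqP //].
by rewrite !inE eqxx /= bB orbT andbT eq_sym ncb.
Qed.

(** By [star_flip] the facets removed are all the facets containing [A]. *)
Lemma in_flip F : (F \in flip Phi A B) =
  (F \in Phi) && ~~ (A \subset F) || (F \in [set H :\ a | a in A]).
Proof.
rewrite !inE; congr (_ || _); rewrite andbC.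
case FP: (F \in Phi) => //=; congr negb; apply/idP/idP.
  case/imsetP => b bB ->; apply/subsetP => x xA; rewrite !inE xA andbT.
  by apply: contraTneq bB => <-; exact: aNB.
by case/(star_flip FP) => b bB ->; apply/imsetP; exists b.
Qed.

(** A subset of [H] that misses some [a] in [A] lies in the new facet [H :\ a]. A face not inside
    [H] lies in a facet outside the star of [A], which survives. *)
Lemma face_flip G : face (flip Phi A B) G = (face Phi G || (G \subset H)) && ~~ (A \subset G).
Proof.
apply/faceP/andP => [[F]|[]].
  rewrite in_flip => /orP[/andP[FP nAF] GF|/imsetP[a aA ->] GF]; split.
  - by apply/orP; left; apply/faceP; exists F.
  - by apply: contra nAF => /subset_trans; apply.
  - by rewrite (subset_trans GF (subD1set _ _)) orbT.
  - by apply/negP => AG; move/subsetP: (subset_trans AG GF) => /(_ _ aA); rewrite setD11.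
case GH: (G \subset H) => /=.
  move=> _ /subsetPn[a aA aG]; exists (H :\ a).
    by rewrite in_flip newP ?orbT.
  by apply/subsetP => x xG; rewrite in_setD1 (subsetP GH) // andbT; apply: contraNneq aG => <-.
rewrite orbF => /faceP[F FP GF] nAG; exists F => //; rewrite in_flip FP /=.
apply/orP; left; apply: contraFN GH => /(star_flip FP)[b bB eF].
by rewrite eF in GF; rewrite (subset_trans GF (subD1set _ _)).
Qed.

Lemma npm_flip : npm (flip Phi A B).
Proof.
split.
- move=> F; rewrite in_flip => /orP[/andP[FP _]|/imsetP[a aA ->]].
    exact: npm_card FP.
  by rewrite crdH // inE aA.
- move=> r F1 F2 F3 cr.
  (* A ridge shared by two distinct new facets contains [B], so no old facet passes through it. *)
  have new2 F a a' : #|F| = d -> a \in A -> a' \in A -> a != a' -> r \subset F ->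
      r \subset H :\ a -> r \subset H :\ a' -> B \subset r.
    move=> cF aA a'A naa' rF ra ra'.
    have rE : r = H :\ a :\ a'.
      apply/eqP; rewrite eqEcard; apply/andP; split.
        apply/subsetP => x xr; move: (subsetP ra _ xr) (subsetP ra' _ xr).
        by rewrite !inE => /andP[-> ->] /andP[->].
      have aH : a \in H by rewrite inE aA.
      have := crdH aH; rewrite (cardsD1 a') !inE eq_sym naa' a'A /=; move: cr; clear; lia.
    apply/subsetP => x xB; rewrite rE !inE xB orbT !andbT.
    by apply/andP; split; apply: contraTneq xB => ->; exact: aNB.
  (* A ridge shared by an old facet and [H :\ a] omits some [b] in [B], since no old facet contains
     [B]. Hence [H :\ b] is a further old facet through it, and the old ridge condition identifies
     [F] and [F'], neither of which contains [A]. *)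
  have mixed F F' a : F \in Phi -> ~~ (A \subset F) -> F' \in Phi -> ~~ (A \subset F') ->
      a \in A -> r \subset F -> r \subset F' -> r \subset H :\ a -> F == F'.
    move=> FP nF F'P nF' aA rF rF' ra.
    have aH : a \in H by rewrite inE aA.
    have : r \proper H :\ a by rewrite properEcard ra crdH // -cr ltnSn.
    case/properP => _ [b bHa br].
    have [bH nba] : b \in H /\ b != a by move: bHa; rewrite !inE => /andP[].
    have rE : r = H :\ a :\ b.
      apply/eqP; rewrite eqEcard; apply/andP; split.
        apply/subsetP => x xr; rewrite in_setD1 (subsetP ra) // andbT.
        by apply: contraNneq br => <-.
      by move: (crdH aH) cr; rewrite (cardsD1 b) bHa /=; clear; lia.
    have bB : b \in B.
      move: (bH); rewrite inE => /orP[bA|//]; case/negP: (oldN FP).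
      apply: subset_trans rF; apply/subsetP => x xB; rewrite rE !inE xB orbT !andbT.
      by apply/andP; split; apply: contraTneq xB => ->; exact: aNB.
    have rb : r \subset H :\ b.
      by apply/subsetP => x; rewrite rE !inE => /and3P[-> _ ->].
    have := npm_ridge nPhi cr FP F'P (oldP bB) rF rF' rb.
    have Ab : A \subset H :\ b.
      apply/subsetP => x xA; rewrite !inE xA andbT.
      by apply: contraTneq bB => <-; exact: aNB.
    by case/or3P => // /eqP e; [case/negP: nF | case/negP: nF']; rewrite e.
  have newo F a a' : F \in Phi -> a \in A -> a' \in A -> r \subset F ->
      r \subset H :\ a -> r \subset H :\ a' -> H :\ a == H :\ a'.
    move=> FP aA a'A rF ra ra'; case: (eqVneq a a') => [->//|naa'].
    have := new2 _ _ _ (npm_card nPhi FP) aA a'A naa' rF ra ra'.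
    by move=> Br; case/negP: (oldN FP); apply: subset_trans Br rF.
  rewrite !in_flip => /orP[/andP[P1 n1]|/imsetP[a1 aA1 e1]]
    /orP[/andP[P2 n2]|/imsetP[a2 aA2 e2]] /orP[/andP[P3 n3]|/imsetP[a3 aA3 e3]] r1 r2 r3.
  + exact: npm_ridge cr P1 P2 P3 r1 r2 r3.
  + by rewrite e3 in r3; rewrite (mixed _ _ _ P1 n1 P2 n2 aA3 r1 r2 r3).
  + by rewrite e2 in r2; rewrite (mixed _ _ _ P1 n1 P3 n3 aA2 r1 r3 r2) orbT.
  + by rewrite e2 e3 in r2 r3 *; rewrite (newo _ _ _ P1 aA2 aA3 r1 r2 r3) !orbT.
  + by rewrite e1 in r1; rewrite (mixed _ _ _ P2 n2 P3 n3 aA1 r2 r3 r1) !orbT.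
  + by rewrite e1 e3 in r1 r3 *; rewrite (newo _ _ _ P2 aA1 aA3 r2 r1 r3) !orbT.
  + by rewrite e1 e2 in r1 r2 *; rewrite (newo _ _ _ P3 aA1 aA2 r3 r1 r2).
  + have hH a : a \in A -> a \in H by rewrite inE => ->.
    have rg a : a \in A -> H :\ a \in ridges H by move=> aA; apply/imsetP; exists a => //; exact: hH.
    move: r1 r2 r3; rewrite e1 e2 e3.
    by apply: (npm_ridge (npm_ridges cAB) cr); exact: rg.
- move=> G.
  have newadj a a' : a \in A -> a' \in A -> G \subset H :\ a -> G \subset H :\ a' ->
      adj (flip Phi A B) G (H :\ a) (H :\ a').
    move=> aA a'A Ga Ga'; rewrite /adj !in_flip !newP // !orbT subsetI Ga Ga' /=.
    have aH : a \in H by rewrite inE aA.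
    have -> : (H :\ a) :&: (H :\ a') = H :\ a :\ a'.
      by apply/setP => x; rewrite !inE; case: (x == a) (x == a') => [] [];
         rewrite ?andbF //= andbb.
    by rewrite -(crdH aH) (cardsD1 a' (H :\ a)); case: (a' \in _).
  have csym : symmetric (connect (adj (flip Phi A B) G)).
    by apply: sym_connect_sym; exact: adj_sym.
  (* A path of old facets is rerouted through the new facets containing G
     whenever it enters the star of A. *)
  have old F F' : F \in Phi -> F' \in Phi -> ~~ (A \subset F) -> G \subset F -> G \subset F' ->
      (~~ (A \subset F') -> connect (adj (flip Phi A B) G) F F') /\
      (A \subset F' -> forall a, a \in A -> G \subset H :\ a ->
         connect (adj (flip Phi A B) G) F (H :\ a)).
    move=> FP F'P nF GF GF'.
    have /connectP[p] := npm_conn nPhi FP F'P GF GF'.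
    elim/last_ind: p F' F'P GF' => [|p K IH] F' F'P GF'.
      by move=> _ /= ->; split => // AF; case/negP: nF.
    rewrite rcons_path last_rcons => /andP[pth /and4P[LP KP GLK cLK]] eF'.
    subst F'; set L := last F p in pth GLK cLK LP.
    move: GLK; rewrite subsetI => /andP[GL GK].
    have [IH1 IH2] := IH L LP GL pth erefl.
    case AL: (A \subset L); case AK: (A \subset K); split => // _.
    + exact: IH2 AL.
    + have [b bB eL] := star_flip LP AL.
      have [a aA aK] := subsetPn (negbT AK).
      have aH : a \in H by rewrite inE aA.
      have Ga : G \subset H :\ a.
        apply/subsetP => x xG; rewrite in_setD1; apply/andP; split.
          by apply: contraNneq aK => <-; exact: (subsetP GK).
        by move: (subsetP GL _ xG); rewrite eL !inE => /andP[].
      apply: connect_trans (IH2 AL a aA Ga) _; apply: connect1.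
      rewrite /adj !in_flip KP AK newP ?orbT //= subsetI Ga GK /=.
      apply: leq_trans cLK _; rewrite ltnS; apply: subset_leq_card.
      apply/subsetP => x; rewrite !inE => /andP[xL xK]; rewrite xK andbT.
      apply/andP; split; first by apply: contraNneq aK => <-.
      by move: xL; rewrite eL !inE => /andP[].
    + move=> a aA Ga; have [b bB eK] := star_flip KP AK.
      have bH : b \in H by rewrite inE bB orbT.
      have [a' a'A a'L] := subsetPn (negbT AL).
      have a'H : a' \in H by rewrite inE a'A.
      have Ga' : G \subset H :\ a'.
        apply/subsetP => x xG; rewrite in_setD1; apply/andP; split.
          by apply: contraNneq a'L => <-; exact: (subsetP GL).
        by move: (subsetP GK _ xG); rewrite eK !inE => /andP[].
      apply: connect_trans (connect1 (newadj _ _ a'A aA Ga' Ga)).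
      apply: connect_trans (IH1 (negbT AL)) _; apply: connect1.
      rewrite /adj !in_flip LP AL newP ?orbT //= subsetI GL Ga' /=.
      apply: leq_trans cLK _; rewrite ltnS; apply: subset_leq_card.
      apply/subsetP => x; rewrite !inE => /andP[xL xK]; rewrite xL /=.
      apply/andP; split; first by apply: contraNneq a'L => <-.
      by move: xK; rewrite eK !inE => /andP[].
    + apply: connect_trans (IH1 (negbT AL)) _; apply: connect1.
      by rewrite /adj !in_flip LP AL KP AK subsetI GL GK.
  (* As [G] does not contain [B], some removed facet [H :\ b] lies around [G]. An old path from [F]
     to it, once rerouted, may end at [H :\ a]. *)
  have oldnew F a : F \in Phi -> ~~ (A \subset F) -> a \in A -> G \subset F ->
      G \subset H :\ a -> connect (adj (flip Phi A B) G) F (H :\ a).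
    move=> FP nF aA GF Ga.
    have [b bB bG] : exists2 b, b \in B & b \notin G.
      by apply/subsetPn; apply: contra (oldN FP) => /subset_trans; apply.
    have Gb : G \subset H :\ b.
      apply/subsetP => x xG; rewrite in_setD1; apply/andP; split.
        by apply: contraNneq bG => <-.
      by move: (subsetP Ga _ xG); rewrite !inE => /andP[].
    have [_] := old _ _ FP (oldP bB) nF GF Gb; apply => //.
    apply/subsetP => x xA; rewrite !inE xA andbT.
    by apply: contraTneq bB => <-; exact: aNB.
  move=> F F'; rewrite !in_flip => /orP[/andP[FP nF]|/imsetP[a aA ->]]
    /orP[/andP[F'P nF']|/imsetP[a' a'A ->]] GF GF'.
  + by have [h _] := old _ _ FP F'P nF GF GF'; apply: h.
  + exact: oldnew.
  + by rewrite csym; exact: oldnew.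
  + exact/connect1/newadj.
Qed.

End Flip.
End Flips.

(** * Flips as changes of a boundary modulo 2 *)

Section Boundary.
Variables (T : finType) (d : nat).
Implicit Types (A B F G H r : {set T}) (X : {set {set T}}).

Definition toggle X H := if H \in X then X :\ H else H |: X.

Lemma odd_toggle X H r : odd #|[set K in toggle X H | r \subset K]| =
  odd #|[set K in X | r \subset K]| (+) (r \subset H).
Proof.
have in1 (Y : {set {set T}}) : H \notin Y -> #|[set K in H |: Y | r \subset K]| =
    (r \subset H) + #|[set K : {set T} in Y | r \subset K]|.
  move=> HY; rewrite (cardsD1 H) !inE eqxx /=; congr (_ + _).
  apply: eq_card => K; rewrite !inE; case: (eqVneq K H) => [->|] //=.
  by rewrite (negPf HY).
rewrite /toggle; case: ifPn => HX; last by rewrite in1 // oddD addbC oddb.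
by rewrite -[in RHS](setD1K HX) in1 ?setD11 // oddD oddb addbAC addbb.
Qed.

Lemma mem_bdry X r : (r \in bdry d X) =
  (#|r| == d) && odd #|[set H : {set T} in X | r \subset H]|.
Proof. by rewrite inE. Qed.

Lemma bdry_sub X r : r \in bdry d X -> exists2 H, H \in X & r \subset H.
Proof.
rewrite mem_bdry => /andP[_]; case: (set_0Vmem [set H : {set T} in X | r \subset H]) => [->|].
  by rewrite cards0.
by case=> H; rewrite inE => /andP[HX rH] _; exists H.
Qed.

Lemma bdry_unique X r H : #|r| = d -> H \in X -> r \subset H ->
  (forall K, K \in X -> r \subset K -> K = H) -> r \in bdry d X.
Proof.
move=> cr HX rH uH; rewrite mem_bdry cr eqxx /=.
suff -> : [set K in X | r \subset K] = [set H] by rewrite cards1.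
apply/setP => K; rewrite !inE; apply/andP/eqP => [[]|->] //; exact: uH.
Qed.

Lemma bdry1 H : #|H| = d.+1 -> bdry d [set H] = ridges H.
Proof.
move=> cH; apply/setP => r; apply/idP/ridgesP => [rb|[h hH ->]].
  have [_ /set1P-> rH] := bdry_sub rb.
  have cr : #|r| = d by move: rb; rewrite mem_bdry => /andP[/eqP].
  have : r \proper H by rewrite properEcard rH cH cr ltnSn.
  case/properP => _ [h hH hr]; exists h => //; apply/eqP; rewrite eqEcard.
  rewrite cr (card_ridge cH hH) leqnn andbT.
  by apply/subsetP => x xr; rewrite !inE (subsetP rH) // andbT; apply: contraNneq hr => <-.
apply: (@bdry_unique _ _ H); rewrite ?set11 ?subD1set //.
- exact: card_ridge cH hH.
- by move=> K /set1P.
Qed.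

(** Modulo 2, adding or removing [H] adds the ridges of [H] to the boundary. Those opposite a vertex
    of [B] cancel. Those opposite a vertex of [A] contain [B], so they are not there yet. *)
Lemma flip_bdry X A B : [disjoint A & B] -> #|A :|: B| = d.+1 ->
  (forall b, b \in B -> (A :|: B) :\ b \in bdry d X) ->
  ~~ face (bdry d X) B -> flip (bdry d X) A B = bdry d (toggle X (A :|: B)).
Proof.
move=> AB cH oldP newB; set H := A :|: B; apply/setP => r.
have [nr|rH] := boolP (r \in ridges H); last first.
  have sN (C : {set T}) : C \subset H -> r \in [set H :\ c | c in C] -> false.
    move=> CH /imsetP[c cC er]; case/negP: rH; rewrite er; apply/imsetP; exists c => //.
    exact: (subsetP CH).
  rewrite !inE; case: (boolP (r \in [set _ | _ in B])) => [/sN|_]; first by rewrite subsetUr => /(_ isT).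
  case: (boolP (r \in [set _ | _ in A])) => [/sN|_]; first by rewrite subsetUl => /(_ isT).
  rewrite orbF /= odd_toggle; case: eqP => //= cr.
  suff -> : (r \subset H) = false by rewrite addbF.
  apply/negP => rsH; case/negP: rH; rewrite -bdry1 //.
  by apply: (@bdry_unique _ _ H); rewrite ?set11 // => K /set1P.
case/ridgesP: nr => h hH ->.
have cr := card_ridge cH hH.
rewrite [RHS]mem_bdry cr eqxx /= odd_toggle subD1set addbT.
have hinj c : c \in H -> H :\ h = H :\ c -> c = h.
  move=> cc /setP/(_ c); rewrite !inE eqxx /=; move: cc; rewrite inE => ->.
  by rewrite andbT => /negbFE/eqP.
move: (hH); rewrite inE => /orP[hA|hB].
  have -> : H :\ h \in flip (bdry d X) A B.
    by rewrite inE; apply/orP; right; apply/imsetP; exists h.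
  symmetry; apply: contra newB => o; apply/faceP; exists (H :\ h).
    by rewrite mem_bdry cr eqxx.
  apply/subsetP => x xB; rewrite !inE xB orbT andbT.
  by apply: contraTneq xB => ->; rewrite (disjointFr AB hA).
have := oldP h hB; rewrite mem_bdry => /andP[_ ->] /=; apply/negbTE.
rewrite !inE negb_or negb_and negbK; apply/andP; split.
  by apply/orP; left; apply/imsetP; exists h.
apply/imsetP => -[a aA /hinj]; rewrite inE aA => /(_ isT) eah.
by move: hB; rewrite -eah (disjointFr AB aA).
Qed.
End Boundary.

(** * Unions of disjoint pairs of consecutive vertices *)

Section Counting.
Variable n : nat.
Implicit Types (F G S : {set 'I_n}) (x y t : 'I_n).

Definition nmem F (k : nat) := [exists x in F, val x == k].
Definition cnt F k := \sum_(i < k) nmem F i.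
(* Gale's evenness condition. *)
Definition paired F := [forall x, (x \in F) || ~~ odd (cnt F x)].
(** Counting off the pairs from below, the upper element of a pair has an odd number of members
    before it. *)
Definition tops F := [set x in F | odd (cnt F x)].
(** An element [x] contributes [n - x], so the weight increases when a set moves down. It serves as
    a rank function for the coordinatewise order. *)
Definition wgt F := \sum_(k < n.+1) cnt F k.

Lemma nmemE F x : nmem F x = (x \in F).
Proof.
apply/existsP/idP => [[z /andP[zF /eqP/val_inj <-]]//|xF].
by exists x; rewrite xF eqxx.
Qed.

Lemma nmem_ord F k (kn : k < n) : nmem F k = (Ordinal kn \in F).
Proof. by rewrite -nmemE. Qed.

Lemma nmem_ge F k : n <= k -> nmem F k = false.
Proof.
by move=> nk; apply/existsP => -[x /andP[_ /eqP e]]; have := ltn_ord x; rewrite [X in X < _]e ltnNge nk.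
Qed.

Lemma cnt0 F : cnt F 0 = 0. Proof. by rewrite /cnt big_ord0. Qed.

Lemma cntS F k : cnt F k.+1 = cnt F k + nmem F k.
Proof. by rewrite /cnt big_ord_recr. Qed.

Lemma cntn F : cnt F n = #|F|.
Proof.
rewrite /cnt -sum1_card [RHS]big_mkcond /=; apply: eq_bigr => i _.
by rewrite nmemE; case: (i \in F).
Qed.

Lemma leq_cnt F j k : j <= k -> cnt F j <= cnt F k.
Proof.
move=> /subnKC <-; elim: (k - j) => [|i IH]; first by rewrite addn0.
by rewrite addnS cntS; exact: leq_trans IH (leq_addr _ _).
Qed.

Lemma cnt_ge F k : n <= k -> cnt F k = #|F|.
Proof.
move=> /subnKC <-; elim: (k - n) => [|i IH]; first by rewrite addn0 cntn.
by rewrite addnS cntS IH nmem_ge ?addn0 // leq_addr.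
Qed.

Lemma cnt_card F k : cnt F k <= #|F|.
Proof.
by rewrite -cntn; case: (leqP k n) => h; [exact: leq_cnt | rewrite cnt_ge ?cntn // ltnW].
Qed.

Lemma cnt_inj F G : (forall k, cnt F k = cnt G k) -> F = G.
Proof.
move=> e; apply/setP => x; rewrite -!nmemE.
have := e x.+1; rewrite !cntS e => /addnI; by case: (nmem F x) (nmem G x) => [] [].
Qed.

Lemma cnt_eq0 F k x : cnt F k = 0 -> x \in F -> k <= x.
Proof.
move=> c0 xF; rewrite leqNgt; apply/negP => xk.
by have := leq_cnt F xk; rewrite c0 cntS nmemE xF addn1.
Qed.

Lemma cnt_full F k x : cnt F k = #|F| -> x \in F -> x < k.
Proof.
move=> c0 xF; rewrite ltnNge; apply/negP => xk.
have := leq_cnt F xk; rewrite c0; have := cnt_card F x.+1.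
rewrite cntS nmemE xF addn1; lia.
Qed.

Lemma cnt_sub0 F k : (forall x, x \in F -> k <= x) -> cnt F k = 0.
Proof.
move=> h; rewrite /cnt big1 // => i _; case: (boolP (nmem F i)) => // /existsP[x /andP[/h kx /eqP e]].
by have := ltn_ord i; rewrite -e ltnNge kx.
Qed.

Lemma cnt_subfull F k : (forall x, x \in F -> x < k) -> cnt F k = #|F|.
Proof.
move=> h; case: (leqP n k) => nk; first exact: cnt_ge.
rewrite -cntn -(subnKC (ltnW nk)); elim: (n - k) => [|i IH]; first by rewrite addn0.
rewrite addnS cntS IH; case: (boolP (nmem F _)) => [|_]; last by rewrite addn0.
by case/existsP=> x /andP[/h xk /eqP e]; move: xk; rewrite e ltnNge leq_addr.
Qed.

Lemma pairedP F x : paired F -> x \notin F -> odd (cnt F x) = false.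
Proof. by move/forallP/(_ x) => + /negPf xF; rewrite xF /= => /negPf. Qed.

Lemma cnt_swap F t x k : t \in F -> x \notin F ->
  cnt (x |: F :\ t) k + (t < k) = cnt F k + (x < k).
Proof.
move=> tF xF; elim: k => [|k IH]; first by rewrite !cnt0 !ltn0.
have ntx : (t : nat) != x by apply: contraNneq xF => /val_inj <-.
rewrite !cntS; have -> : nmem (x |: F :\ t) k = (k == x) || (k != t) && nmem F k.
  case: (ltnP k n) => kn; last first.
    by rewrite !nmem_ge // andbF orbF; apply/esym/negbTE; rewrite gtn_eqF // (leq_trans (ltn_ord x) kn).
  by rewrite !nmem_ord !inE.
have tk : nmem F t by rewrite nmemE.
have xk : nmem F x = false by rewrite nmemE (negPf xF).
have [ekt|nkt] := eqVneq k t; have [ekx|nkx] := eqVneq k x => /=; last first.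
- have lt (y : 'I_n) : k != y -> (y < k.+1) = (y < k).
    by move=> nky; rewrite ltnS leq_eqVlt eq_sym (negPf nky).
  by rewrite !lt //; move: IH; clear; lia.
- by subst k; rewrite xk; lia.
- by subst k; rewrite tk; lia.
- by move: ntx; rewrite -ekt -ekx eqxx.
Qed.

Lemma card_swap F t x : t \in F -> x \notin F -> #|x |: F :\ t| = #|F|.
Proof. by move=> tF xF; have := cnt_swap n tF xF; rewrite !cntn !ltn_ord => /addIn. Qed.

(** Counts change parity only between [x] and [t], where there are no gaps. The parity hypothesis
    lets an upper element move down or a lower element move up, so that the vacated place [t] gets
    an even count. *)
Lemma paired_swap F t x : paired F -> t \in F -> x \notin F ->
  (forall y, (x < y) (+) (t < y) -> y != t -> y != x -> y \in F) ->
  odd (cnt F t) = (x < t) -> paired (x |: F :\ t).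
Proof.
move=> pF tF xF btw ot; apply/forallP => y; rewrite !inE.
have [->|nyx] := eqVneq y x => //=; have := cnt_swap y tF xF.
have ntx : t != x by apply: contraNneq xF => <-.
have [->|nyt] := eqVneq y t => /=.
  by rewrite ltnn addn0 => ->; rewrite oddD ot oddb addbb.
have [yF//|yF] := boolP (y \in F).
have -> : (x < y) = (t < y).
  by case xy: (x < y); case ty: (t < y) => //; case/negP: yF; apply: btw; rewrite ?xy ?ty.
by move=> /addIn ->; rewrite (pairedP pF yF).
Qed.

Lemma cntU1 F x k : x \notin F -> cnt (x |: F) k = cnt F k + (x < k).
Proof.
move=> xF; elim: k => [|k IH]; first by rewrite !cnt0 ltn0.
rewrite !cntS IH; case: (ltnP k n) => kn; last first.
  by have xk := leq_trans (ltn_ord x) kn; rewrite !nmem_ge // !addn0 xk ltnS ltnW.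
rewrite !nmem_ord !inE -val_eqE /= ltnS (leq_eqVlt x) (eq_sym (x : nat)).
case: (eqVneq k x) => [ekx|_] /=; last by rewrite addnAC.
have -> : (Ordinal kn \in F) = false.
  by rewrite (_ : Ordinal kn = x) ?(negPf xF) //; apply: val_inj.
by rewrite -ekx ltnn !addn0.
Qed.

(* The parity of [cnt] separates the (at most two) vertices that complete a
   ridge to a paired set. *)
Lemma paired_completion (r : {set 'I_n}) x y : x \notin r -> y \notin r ->
  paired (x |: r) -> paired (y |: r) -> x < y ->
  odd (cnt r x) = false /\ odd (cnt r y).
Proof.
move=> xr yr px py xy.
split.
  have : x \notin y |: r by rewrite !inE (negPf xr) orbF neq_ltn xy.
  by move/(pairedP py); rewrite cntU1 // ltnNge (ltnW xy) addn0.
have : y \notin x |: r by rewrite !inE (negPf yr) orbF neq_ltn xy orbT.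
by move/(pairedP px); rewrite cntU1 // xy oddD addbT => /negbFE.
Qed.

Lemma cnt_tops F k : cnt (tops F) k = (cnt F k)./2.
Proof.
elim: k => [|k IH]; first by rewrite !cnt0.
rewrite !cntS IH; have -> : nmem (tops F) k = nmem F k && odd (cnt F k).
  case: (ltnP k n) => kn; last by rewrite !nmem_ge.
  by rewrite !nmem_ord inE.
case: (nmem F k) => /=; rewrite ?addn0 //.
by rewrite addn1 -uphalfE uphalf_half addnC.
Qed.

Lemma card_tops F : #|tops F| = #|F|./2.
Proof. by rewrite -!cntn cnt_tops. Qed.

Lemma paired_succ F x : paired F -> ~~ odd #|F| -> x \in F -> ~~ odd (cnt F x) -> nmem F x.+1.
Proof.
move=> pF cF xF ox; apply: contraT => nx.
have : odd (cnt F x.+1) by rewrite cntS nmemE xF addn1 /= ox.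
case: (ltnP x.+1 n) => xn; last by rewrite cnt_ge // (negPf cF).
by move: nx; rewrite (nmem_ord _ xn) => /(pairedP pF) /= ->.
Qed.

End Counting.

(** * Cells: order, adjacency across ridges, and translation *)

Section Cells.
Variables (n m : nat).
Implicit Types (F G S : {set 'I_n}) (x y t : 'I_n) (a b : nat).

Definition cell a b F := [&& paired F, #|F| == m.*2, cnt F a == 0 & cnt F b == m.*2].
(* The restriction face of F in the shelling: the upper elements of the pairs
   that can still be moved down inside [a, oo). *)
Definition dtops a F := [set t in tops F | [exists y : 'I_n, [&& a <= y, y < t & y \notin F]]].
(** For sets of equal size this is the coordinatewise order of the sorted elements, with [F] the
    smaller set. *)
Definition below F G := forall k, cnt G k <= cnt F k.

Lemma cellP a b F : cell a b F ->
  [/\ paired F, #|F| = m.*2, cnt F a = 0 & cnt F b = m.*2].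
Proof. by case/and4P => ? /eqP ? /eqP ? /eqP ?. Qed.

Lemma cell_bounds a b F x : cell a b F -> x \in F -> a <= x < b.
Proof.
case/cellP => _ cF c0 cb xF; rewrite (cnt_eq0 c0 xF) /=.
by apply: cnt_full xF; rewrite cF.
Qed.

Lemma cellI a b F : paired F -> #|F| = m.*2 -> (forall x, x \in F -> a <= x < b) -> cell a b F.
Proof.
move=> pF cF h; rewrite /cell pF cF eqxx /=; apply/andP; split.
  by rewrite cnt_sub0 // => x /h /andP[].
by rewrite cnt_subfull ?cF // => x /h /andP[].
Qed.

Lemma below_wgt F G : below F G -> wgt G <= wgt F ?= iff (F == G).
Proof.
move=> h; have := @leqif_sum 'I_n.+1 xpredT (fun i => cnt G i == cnt F i) (fun i => cnt G i) (fun i => cnt F i).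
move=> /(_ (fun i _ => leqif_eq (h i))) [le eq]; split => //; rewrite eq.
apply/idP/eqP => [/forallP e|->]; last by apply/forallP => i /=; rewrite eqxx.
apply: cnt_inj => k.
have kn : minn k n < n.+1 by rewrite ltnS geq_minr.
have := e (Ordinal kn) => /= /eqP; rewrite /minn; case: ltnP => [//|nk].
by rewrite !(cnt_ge _ nk) !cntn.
Qed.

(* Downward induction on k: at a vertex outside G a parity mismatch gains
   the missing unit. *)
Lemma dtops_below a b F G : cell a b F -> cell a b G -> dtops a F \subset G -> below F G.
Proof.
move=> cF cG sub; have [pF nF F0 Fb] := cellP cF; have [pG nG G0 Gb] := cellP cG.
move=> k; have [bk|kb] := leqP b k.
  by rewrite (leq_trans (cnt_card _ _)) // nG -Fb leq_cnt.
have : k <= b by exact: ltnW.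
move: (b - k) (subnK (ltnW kb)) => j; elim: j k {kb} => [|j IH] k.
  by rewrite add0n => -> _; rewrite Fb Gb.
rewrite addSnnS => ej kb.
have kb' : k < b by lia.
have := IH k.+1 ej kb'; rewrite !cntS.
have [ka|ak] := leqP k a.
  by have := leq_cnt G ka; rewrite G0 leqn0 => /eqP -> _.
case: (boolP (nmem F k)) => kF; last lia.
case: (boolP (nmem G k)) => kG; first lia.
rewrite addn0 addn1 => le.
have kn : k < n by rewrite ltnNge; apply: contraL kF => /nmem_ge ->.
have oG : odd (cnt G k) = false.
  by apply: (@pairedP _ _ (Ordinal kn)) => //; rewrite -nmem_ord.
case oF : (odd (cnt F k)); last first.
  rewrite leq_eqVlt ltnS in le; case/orP: le => // /eqP e.
  by move: oG; rewrite e /= oF.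
case: (boolP (Ordinal kn \in dtops a F)) => [/(subsetP sub)|].
  by rewrite -nmem_ord (negPf kG).
rewrite !inE -nmem_ord kF oF /= negb_exists => /forallP ini.
(* Since [k] is an upper element that cannot be moved down, [F] contains all of [[a, k)]. So its
   count at [k] is [k - a], the largest value available to a cell starting at [a]. *)
have full i : i <= k - a -> cnt F (a + i) = i.
  elim: i => [|i IHi] ik; first by rewrite addn0.
  rewrite addnS cntS IHi ?(ltnW ik) //.
  have ain : a + i < n by move: ik kn; clear; lia.
  have := ini (Ordinal ain); rewrite /= leq_addr -(nmem_ord) /=.
  have -> /= : a + i < k by move: ik; clear; lia.
  by rewrite negbK => ->; rewrite addn1.
have small i : cnt G (a + i) <= i.
  elim: i => [|i IHi]; first by rewrite addn0 G0.
  by rewrite addnS cntS; move: IHi; case: nmem; rewrite ?addn1 ?addn0 //; exact: leqW.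
by rewrite -(subnKC (ltnW ak)) full.
Qed.

Lemma completion F G t : t \in F -> #|F| = #|G| -> G != F -> F :\ t \subset G ->
  exists2 x, x \notin F & G = x |: F :\ t.
Proof.
move=> tF cFG nGF sub.
have tG : t \notin G.
  apply: contra nGF => tG; rewrite eq_sym eqEcard cFG leqnn andbT.
  by rewrite -(setD1K tF) subUset sub1set tG.
have cF := cardsD1 t F; rewrite tF in cF.
have /properP[_ [x xG xr]] : F :\ t \proper G.
  by rewrite properEcard sub -cFG cF ltnS leqnn.
have xF : x \notin F.
  by move: xr; rewrite !inE negb_and negbK => /orP[/eqP ext|//]; rewrite -ext xG in tG.
exists x => //; apply/eqP; rewrite eq_sym eqEcard subUset sub1set xG sub /=.
by rewrite cardsU1 xr -cFG cF.
Qed.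

(** By [paired_completion] two different vertices completing the ridge have counts of opposite
    parity. Three vertices cannot have pairwise opposite parities. *)
Lemma cell_completion a b F G G' t : cell a b F -> cell a b G -> cell a b G' ->
  t \in F -> G != F -> G' != F -> F :\ t \subset G -> F :\ t \subset G' -> G = G'.
Proof.
move=> /cellP[pF nF _ _] /cellP[pG nG _ _] /cellP[pG' nG' _ _] tF nGF nGF' sG sG'.
have [x xF eG] := completion tF (etrans nF (esym nG)) nGF sG.
have [y yF eG'] := completion tF (etrans nF (esym nG')) nGF' sG'.
set r := F :\ t in eG eG' *.
have nr z : z \notin F -> z \notin r by rewrite !inE negb_and => ->; rewrite orbT.
have tr : t \notin r by rewrite !inE eqxx.
rewrite -(setD1K tF) -/r in pF; rewrite eG in pG *; rewrite eG' in pG' *.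
have wl u v : u \notin r -> v \notin r -> paired (u |: r) -> paired (v |: r) ->
    u != v -> odd (cnt r u) != odd (cnt r v).
  move=> ur vr pu pv; rewrite -val_eqE neq_ltn => /orP[uv|vu].
    by have [-> ->] := paired_completion ur vr pu pv uv.
  by have [-> ->] := paired_completion vr ur pv pu vu.
have [->//|nxy] := eqVneq x y.
have ntx : t != x by apply: contraNneq xF => <-.
have nty : t != y by apply: contraNneq yF => <-.
have := wl _ _ tr (nr _ xF) pF pG ntx; have := wl _ _ tr (nr _ yF) pF pG' nty.
have := wl _ _ (nr _ xF) (nr _ yF) pG pG' nxy.
by case: (odd _) (odd _) (odd _) => [] [] [].
Qed.

Lemma below_swap F t x : t \in F -> x \notin F -> x < t -> below (x |: F :\ t) F.
Proof.
move=> tF xF xt k; have := cnt_swap k tF xF.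
case: (ltnP t k) => [/(ltn_trans xt) ->|_]; first by move/addIn->.
by rewrite addn0 => ->; rewrite leq_addr.
Qed.

(** If [t] were exchanged for a larger vertex, it would become a gap of [G] with an odd count. *)
Lemma tops_completion a b F G t : cell a b F -> cell a b G -> t \in tops F ->
  G != F -> F :\ t \subset G -> below G F.
Proof.
move=> /cellP[pF nF _ _] /cellP[pG nG _ _]; rewrite inE => /andP[tF ot] nGF sG.
have [x xF eG] := completion tF (etrans nF (esym nG)) nGF sG.
rewrite eG; apply: below_swap => //; rewrite ltnNge leq_eqVlt negb_or.
have ntx : (t : nat) != x by apply: contraNneq xF => /val_inj <-.
rewrite ntx /=; apply/negP => tx.
have tr : t \notin F :\ t by rewrite !inE eqxx.
have xr : x \notin F :\ t by rewrite !inE negb_and xF orbT.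
rewrite eG in pG; have := pF; rewrite -(setD1K tF) => pF'.
have [o _] := paired_completion tr xr pF' pG tx.
have := cnt_swap t tF xF; rewrite ltnn ltnNge (ltnW tx) !addn0 => e.
have tG : t \notin x |: F :\ t by rewrite !inE eqxx orbF -val_eqE /=.
by have := pairedP pG tG; rewrite e ot.
Qed.

(** The upper element [t] jumps down over a block of [F] to the nearest gap. This gives the
    neighbour of [F] across the ridge [F :\ t], which precedes [F] in the shelling. *)
Lemma cell_swap a b F t : cell a b F -> t \in dtops a F ->
  exists x, [/\ x \notin F, x < t, forall y, x < y -> y < t -> y \in F &
    cell a b (x |: F :\ t)].
Proof.
move=> cF; have [pF nF _ _] := cellP cF.
rewrite !inE => /andP[/andP[tF ot] /existsP[y0 P0]].
case: (@arg_maxnP _ y0 (fun y : 'I_n => [&& a <= y, y < t & y \notin F]) (fun y => y : nat) P0).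
move=> x /and3P[ax xt xF] xmax.
have btw y : x < y -> y < t -> y \in F.
  move=> xy yt; apply: contraT => yF.
  have := xmax y; rewrite (leq_trans ax (ltnW xy)) yt yF => /(_ isT) /(leq_trans xy).
  by rewrite ltnn.
exists x; split=> //; apply: cellI.
- apply: paired_swap => // [y|]; last by rewrite xt.
  case xy: (x < y) => /=; last by move=> ty; rewrite (ltn_trans xt ty) in xy.
  by rewrite -leqNgt => yt nyt _; apply: btw; rewrite // ltn_neqAle nyt.
- by rewrite card_swap.
- have [at_ tb] := andP (cell_bounds cF tF).
  move=> z; rewrite !inE => /orP[/eqP->|/andP[_ zF]]; last exact: cell_bounds cF zF.
  by rewrite ax (ltn_trans xt).
Qed.

(** Vertex 0 jumps over the initial block of [F] to the first gap, which lies below [b] because [F]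
    has only [m.*2 < b] elements. *)
Lemma cell_raise b F t : cell 0 b F -> t \in F -> t = 0 :> nat -> m.*2 < b <= n ->
  exists2 x, x \notin F & cell 1 b (x |: F :\ t).
Proof.
move=> cF tF t0 /andP[mb bn]; have [pF nF _ _] := cellP cF.
have [y0 /andP[y0b y0F]] : exists y : 'I_n, (y < b) && (y \notin F).
  apply/existsP; apply: contraLR mb; rewrite negb_exists -leqNgt => /forallP h.
  have full i : i <= b -> cnt F i = i.
    elim: i => [|i IH] ib; first by rewrite cnt0.
    have iN : i < n by exact: leq_trans bn.
    rewrite cntS IH ?(ltnW ib) //.
    by have := h (Ordinal iN); rewrite /= ib negbK nmem_ord => ->; rewrite addn1.
  by rewrite -(full b) // -nF cnt_card.
case: (@arg_minnP _ y0 (fun y => y \notin F) (fun y => y : nat) y0F) => x xF xmin.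
have tx : t < x.
  by rewrite t0 lt0n; apply: contraNneq xF => x0; rewrite (_ : x = t) //; apply: val_inj; rewrite /= x0 t0.
exists x => //; apply: cellI.
- apply: paired_swap => // [y|]; last by rewrite {1}t0 cnt0 ltnNge (ltnW tx).
  move=> btw nyt nyx; apply: contraT => yF.
  have := xmin y yF; rewrite leq_eqVlt eq_sym val_eqE (negPf nyx) /= => xy.
  by move: btw; rewrite xy (ltn_trans tx xy).
- by rewrite card_swap.
- move=> z; rewrite !inE => /orP[/eqP->|/andP[nzt zF]].
    by rewrite -t0 tx (leq_ltn_trans (xmin _ y0F)).
  have /andP[_ ->] := cell_bounds cF zF.
  by rewrite lt0n -t0 val_eqE nzt.
Qed.

(** Translations by one inside a fixed vertex set: [up] drops the last vertex and [dn] drops vertex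
    0, whence the conditions [b < n] and [~~ nmem F 0] in the lemmas on them. *)
Definition up F := [set y : 'I_n | (0 < y) && nmem F y.-1].
Definition dn F := [set y : 'I_n | nmem F y.+1].

Lemma cnt_up F k : k < n -> cnt (up F) k.+1 = cnt F k.
Proof.
elim: k => [|k IH] kn; rewrite cntS; last first.
  by rewrite IH ?(ltnW kn) // (nmem_ord _ kn) inE /= cntS.
by rewrite (nmem_ord _ kn) inE /= !cnt0.
Qed.

Lemma cnt_dn F k : ~~ nmem F 0 -> cnt (dn F) k = cnt F k.+1.
Proof.
move=> F0; elim: k => [|k IH]; first by rewrite cntS !cnt0 (negPf F0).
rewrite cntS IH [RHS]cntS; congr (_ + nat_of_bool _).
by case: (ltnP k n) => kn; [rewrite (nmem_ord _ kn) inE | rewrite !nmem_ge // leqW].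
Qed.

Lemma dnK F : ~~ nmem F 0 -> up (dn F) = F.
Proof.
move=> F0; apply: cnt_inj; case=> [|k]; first by rewrite !cnt0.
case: (ltnP k n) => kn; first by rewrite cnt_up // cnt_dn.
have n0 : #|up (dn F)| = #|F|; last by rewrite !cnt_ge // leqW.
have [n0|n0] := posnP n; first by rewrite -!(@cnt_ge _ _ 0) ?n0 // !cnt0.
have nn : n <= n.-1.+1 by rewrite prednK.
by rewrite -!(cnt_ge _ nn) cnt_up ?cnt_dn // ltn_predL.
Qed.

Lemma cell_up b F : b < n -> cell 0 b F -> cell 1 b.+1 (up F).
Proof.
move=> bn /cellP[pF nF F0 Fb]; have nE : n.-1.+1 = n by case: (n) bn.
rewrite /cell (cnt_up _ bn) Fb eqxx andbT; apply/and3P; split.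
- apply/forallP => y; rewrite inE; case yE: (nat_of_ord y) => [|k] /=; first by rewrite cnt0.
  have kn : k < n by rewrite ltnW // -yE.
  by rewrite cnt_up // (nmem_ord _ kn); exact: (forallP pF (Ordinal kn)).
- have nn : n <= n.-1.+1 by rewrite nE.
  rewrite -(cnt_ge _ nn) cnt_up ?nE // eqn_leq -{1}nF cnt_card -Fb leq_cnt //.
  by rewrite -ltnS nE.
- by rewrite cnt_up ?cnt0 // (leq_trans _ bn).
Qed.

Lemma cell_dn b F : cell 1 b.+1 F -> cell 0 b (dn F).
Proof.
case/cellP=> pF nF F1 Fb.
have F0 : ~~ nmem F 0 by move: F1; rewrite cntS cnt0; case: nmem.
rewrite /cell !cnt_dn // Fb F1 !eqxx !andbT; apply/andP; split.
- apply/forallP => y; rewrite inE cnt_dn //; case: (boolP (nmem F y.+1)) => //= yF.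
  case: (ltnP y.+1 n) => yn; last by rewrite cnt_ge // nF odd_double.
  by rewrite (nmem_ord _ yn) in yF; have := pairedP pF yF => /= ->.
- by rewrite -cntn cnt_dn // cnt_ge ?leqnSn // nF.
Qed.

Lemma cell_weaken a b a' b' F : a' <= a -> b <= b' -> cell a b F -> cell a' b' F.
Proof.
move=> aa bb cF; have [pF nF _ _] := cellP cF; apply: cellI => // x /(cell_bounds cF).
by case/andP => /(leq_trans aa) -> /leq_trans ->.
Qed.

Lemma cell_pos b F : cell 0 b F -> ~~ nmem F 0 -> cell 1 b F.
Proof.
move=> cF F0; have [pF nF _ _] := cellP cF; apply: cellI => // x xF.
have /andP[_ ->] := cell_bounds cF xF; rewrite andbT lt0n.
by apply: contra F0 => /eqP <-; rewrite nmemE.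
Qed.

Lemma cnt_up_cell b F k : b < n -> cell 0 b F -> cnt (up F) k.+1 = cnt F k.
Proof.
move=> bn cF; case: (ltnP k n) => kn; first exact: cnt_up.
have [_ nF _ _] := cellP cF; have [_ nU _ _] := cellP (cell_up bn cF).
by rewrite !cnt_ge ?nF ?nU // leqW.
Qed.

Lemma below_up b F : b < n -> cell 0 b F -> below F (up F).
Proof.
by move=> bn cF k; rewrite -(cnt_up_cell k bn cF); exact: leq_cnt.
Qed.

Lemma below_dn F : ~~ nmem F 0 -> below (dn F) F.
Proof. by move=> F0 k; rewrite cnt_dn //; exact: leq_cnt. Qed.

Lemma below_wgt_eq F G : below F G -> wgt F <= wgt G -> F = G.
Proof.
by move=> /below_wgt[le e] ge; apply/eqP; rewrite -e eqn_leq le ge.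
Qed.

Lemma dtops_tops a F : (forall x : 'I_n, x \in F -> a < x) -> dtops a F = tops F.
Proof.
move=> h; apply/setP => t; rewrite inE; apply/andb_idr; rewrite inE => /andP[tF ot].
have ta := h _ tF; have an : a < n by exact: ltn_trans (ltn_ord t).
apply/existsP; exists (Ordinal an); rewrite /= leqnn ta /=.
by apply/negP => /h /=; rewrite ltnn.
Qed.

(** Pairs are consecutive, so translation carries lower elements to upper ones. Hence the set lost
    when [up F] is added comes back when [F] is removed. *)
Lemma bottoms_up b F : b < n -> cell 0 b F -> up F :\: tops (up F) \subset tops F.
Proof.
move=> bn cF; apply/subsetP => x; rewrite inE => /andP[xt xU].
have := xU; rewrite inE => /andP[x0].
have kn : x.-1 < n by rewrite prednK // ltnW.
rewrite (nmem_ord _ kn) => kF; have [pF nF _ _] := cellP cF.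
have ev : ~~ odd (cnt F x.-1).
  by rewrite -(cnt_up_cell _ bn cF) prednK //; move: xt; rewrite inE xU.
have := @paired_succ _ F (Ordinal kn) pF; rewrite nF odd_double => /(_ isT kF ev) /=.
rewrite prednK // nmemE inE => xF; rewrite xF /= -(prednK x0) cntS oddD (negPf ev).
by rewrite (nmem_ord _ kn) kF.
Qed.

(** The pair formed by 0 and 1 cannot move down, so its upper element is missing from
    [dtops 0 F]. *)
Lemma card_dtops0 b F : 0 < m -> cell 0 b F -> nmem F 0 -> #|dtops 0 F| < m.
Proof.
move=> m0 cF F0; have [pF nF _ _] := cellP cF.
have n0 : 0 < n by rewrite ltnNge; apply: contraL F0 => /nmem_ge ->.
have F1 : nmem F 1.
  apply: (@paired_succ _ F (Ordinal n0)) => //; rewrite ?nF ?odd_double -?nmem_ord //.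
  by rewrite cnt0.
have n1 : 1 < n by rewrite ltnNge; apply: contraL F1 => /nmem_ge ->.
have : dtops 0 F \proper tops F.
  apply/properP; split; first by apply/subsetP => x; rewrite inE => /andP[].
  exists (Ordinal n1).
    by rewrite inE -nmem_ord F1 /= cntS cnt0 F0.
  rewrite inE negb_and; apply/orP; right; apply/existsP => -[y /and3P[_ /=]].
  rewrite ltnS leqn0 => /eqP y0; rewrite -nmemE y0 F0; by [].
by move/proper_card; rewrite card_tops nF doubleK.
Qed.

End Cells.

(** Greedy choice: the least element [x] of [S] is paired with [x.+1], and what remains is covered
    further right. If no element of [S] leaves enough room, [S] lies in the final block of [[a, b)]
    of the required size, which is itself a cell. *)
Lemma cell_cover n m a b (S : {set 'I_n}) : #|S| <= m -> a + m.*2 <= b -> b <= n ->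
  (forall x, x \in S -> a <= x < b) -> exists2 F, cell m a b F & S \subset F.
Proof.
elim: m a S => [|m IH] a S.
  rewrite leqn0 cards_eq0 => /eqP-> _ _ _; exists set0; rewrite ?sub0set //.
  apply: cellI => [||x]; rewrite ?cards0 ?inE //; apply/forallP => x.
  by rewrite cnt_sub0 ?orbT // => y; rewrite inE.
move=> cS ab bn hS.
have [[x0 x0S x0b]|far] : {x0 : 'I_n | x0 \in S & x0 + m.+1.*2 <= b} +
    (forall x, x \in S -> b < x + m.+1.*2).
  case: (pickP (fun x : 'I_n => (x \in S) && (x + m.+1.*2 <= b))) => [x /andP[xS xb]|h].
    by left; exists x.
  by right => x xS; have := h x; rewrite xS /= leqNgt => /negbFE.
- have x0S' : x0 \in S by [].
  case: (@arg_minnP _ x0 (fun y => y \in S) (fun y => y : nat) x0S') => x xS xmin.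
  have xb : x.+2 + m.*2 <= b by have := xmin _ x0S; move: x0b; rewrite doubleS; clear; lia.
  have x1n : x.+1 < n by move: xb bn; clear; lia.
  set x1 := Ordinal x1n.
  have [|//|//|y|F cF sF] := IH x.+2 (S :\ x :\ x1).
  + have e : #|S| = #|S :\ x|.+1 by rewrite (cardsD1 x) xS.
    have : #|S :\ x :\ x1| <= #|S :\ x| by apply: subset_leq_card; rewrite subD1set.
    by move: e cS; clear; lia.
  + rewrite !inE -!val_eqE /= => /and3P[n1 n0 yS].
    have := xmin _ yS; have /andP[_ ->] := hS _ yS; rewrite andbT.
    by move: n1 n0; clear; lia.
  have [pF nF F0 Fb] := cellP cF.
  have x1F : x1 \notin F by apply/negP => /(cell_bounds cF); rewrite /= ltnn.
  have xF : x \notin x1 |: F.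
    rewrite !inE -val_eqE /= ltn_eqF //=.
    by apply/negP => /(cell_bounds cF) /andP[]; rewrite ltnNge leqnSn.
  exists (x |: (x1 |: F)).
    apply: cellI => [||y].
    * apply/forallP => y; rewrite !inE -!val_eqE /=.
      case: (eqVneq (y : nat) x) => //= nyx; case: (eqVneq (y : nat) x.+1) => //= nyx1.
      have [//|yF] := boolP (y \in F); rewrite !cntU1 // -addnA oddD (pairedP pF yF) /=.
      have -> : (x < y) = (x.+1 < y) by move: nyx nyx1; clear; lia.
      by rewrite oddD addbb.
    * by rewrite cardsU1 xF cardsU1 x1F nF doubleS.
    * have /andP[ax _] := hS _ xS; rewrite !inE => /or3P[/eqP->|/eqP->|/(cell_bounds cF)] /=.
      - by rewrite ax; move: xb; clear; lia.
      - by move: ax xb; clear; lia.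
      - by move: ax; clear; lia.
  apply/subsetP => y yS; rewrite !inE; case: (eqVneq y x) => //= nyx.
  case: (eqVneq y x1) => //= nyx1; apply: (subsetP sF).
  by rewrite !inE nyx nyx1 yS.
set k := b - m.+1.*2.
have bE : b = k + m.+1.*2 by rewrite subnK //; move: ab; clear; lia.
have cE j : cnt [set x : 'I_n | k <= x < b] j = minn j b - k.
  elim: j => [|j IHj]; first by rewrite cnt0 min0n.
  rewrite cntS IHj; have -> : nmem [set x : 'I_n | k <= x < b] j = (k <= j < b).
    case: (ltnP j n) => jn; first by rewrite (nmem_ord _ jn) inE.
    by rewrite nmem_ge //; move: jn bn; clear; lia.
  by move: bE; clear; lia.
exists [set x : 'I_n | k <= x < b].
  apply: cellI => [||x].
  + apply/forallP => y; rewrite inE; case: (boolP (k <= y < b)) => //= yk.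
    rewrite cE; have [->|->] : minn y b - k = 0 \/ minn y b - k = m.+1.*2.
      by move: yk bE; clear; lia.
    by [].
    by rewrite odd_double.
  + by rewrite -cntn cE; move: bE bn; clear; lia.
  + by rewrite inE; move: bE ab; clear; lia.
by apply/subsetP => x xS; rewrite inE; move: (far _ xS) (hS _ xS) bE; clear; lia.
Qed.

(** * Shellings and the spheres built from them *)

Inductive flip_sphere (T : finType) (d : nat) : {set {set T}} -> Prop :=
| FlipSimplex (H : {set T}) : #|H| = d.+1 -> flip_sphere d (ridges H)
| FlipStep (Phi : {set {set T}}) (A B : {set T}) : flip_sphere d Phi ->
    [disjoint A & B] -> #|A :|: B| = d.+1 -> A != set0 -> B != set0 ->
    (forall b, b \in B -> (A :|: B) :\ b \in Phi) -> ~~ face Phi B ->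
    flip_sphere d (flip Phi A B).

Lemma flip_sphere_npm (T : finType) d (Phi : {set {set T}}) :
  flip_sphere d Phi -> npm d Phi.
Proof. by elim=> *; [exact: npm_ridges | exact: npm_flip]. Qed.

Section Steps.
Variables (T : finType) (d : nat).
Implicit Types (B F G H : {set T}) (X : {set {set T}}).

(** One step of a shelling or of its reversal: [H] enters or leaves the ball, [B] appears in the
    boundary, and [H :\: B] disappears from it. *)
Lemma bdry_step X H B : flip_sphere d (bdry d X) -> #|H| = d.+1 ->
  B \subset H -> B != set0 -> B != H ->
  (forall b, b \in B -> H :\ b \in bdry d X) -> ~~ face (bdry d X) B ->
  flip_sphere d (bdry d (toggle X H)) /\
  forall G, face (bdry d (toggle X H)) G =
    (face (bdry d X) G || (G \subset H)) && ~~ (H :\: B \subset G).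
Proof.
move=> sX cH BH B0 nBH oldP newB; set A := H :\: B.
have AB : A :|: B = H.
  apply/setP => x; rewrite !inE; case: (boolP (x \in B)) => [/(subsetP BH)->|_] //=.
  by rewrite orbF.
have dAB : [disjoint A & B].
  by rewrite disjoint_subset; apply/subsetP => x; rewrite !inE => /andP[].
have A0 : A != set0.
  by rewrite setD_eq0; apply: contra nBH => HB; rewrite eqEsubset BH.
have e : flip (bdry d X) A B = bdry d (toggle X H).
  by rewrite -AB flip_bdry // AB.
have nX := flip_sphere_npm sX.
rewrite -e; split; first by apply: FlipStep; rewrite ?AB.
by move=> G; rewrite (face_flip nX) ?AB.
Qed.

Lemma toggle_in X H : H \in X -> toggle X H = X :\ H.
Proof. by rewrite /toggle => ->. Qed.

Lemma toggle_notin X H : H \notin X -> toggle X H = H |: X.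
Proof. by rewrite /toggle => /negPf ->. Qed.

End Steps.

(** * Shelling of lower sets of cells *)

Section Build.
Variables (n m : nat).
Local Notation cell := (@cell n m).
Local Notation dtops := (@dtops n).
Implicit Types (F G Z : {set 'I_n}) (J D I : {set {set 'I_n}}).

Definition lower a b J := (forall F, F \in J -> cell a b F) /\
  forall F G, F \in J -> cell a b G -> below G F -> G \in J.

(** A cell of least weight is maximal in the order, so what remains is still a lower set. *)
Lemma lower_last a b J : lower a b J -> J != set0 ->
  exists F, [/\ F \in J, lower a b (J :\ F) &
    forall G, G \in J -> below F G -> G = F].
Proof.
move=> [Jc Jl] /set0Pn[F0 F0J].
case: (@arg_minnP _ F0 (fun F => F \in J) (@wgt n) F0J) => F FJ Fmin.
have last G : G \in J -> below F G -> G = F.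
  by move=> GJ FG; apply/esym/below_wgt_eq => //; exact: Fmin.
exists F; split => //; split => [G /setD1P[_]|G K /setD1P[nGF GJ] cK KG]; first exact: Jc.
rewrite in_setD1 (Jl _ _ GJ cK KG) andbT; apply: contra nGF => /eqP eKF.
by rewrite (last G) // -eKF.
Qed.

Lemma apex_inj Z F G : (forall x, x \in F -> x \notin Z) -> (forall x, x \in G -> x \notin Z) ->
  Z :|: F = Z :|: G -> F = G.
Proof.
move=> hF hG e; apply/setP => x; apply/idP/idP => h.
  have : x \in Z :|: G by rewrite -e inE h orbT.
  by rewrite inE (negPf (hF _ h)).
have : x \in Z :|: F by rewrite e inE h orbT.
by rewrite inE (negPf (hG _ h)).
Qed.

Lemma apex_sub Z F G : (forall x, x \in F -> x \notin Z) -> (F \subset Z :|: G) = (F \subset G).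
Proof.
move=> h; apply/idP/idP => [|/subset_trans]; last by apply; exact: subsetUr.
by move/subsetP => s; apply/subsetP => x xF; have := s x xF; rewrite inE (negPf (h x xF)).
Qed.

(* Kalai's shelling of a squeezed ball, with every cell coned from Z. *)
Lemma build Z a b d k J : (forall z, z \in Z -> z < a) -> d.+1 = #|Z| + m.*2 ->
  lower a b J -> J != set0 ->
  (forall F, F \in J -> k + #|dtops a F| < d.+1) ->
  flip_sphere d (bdry d [set Z :|: F | F in J]) /\
  forall G, #|G| <= k -> (exists2 F, F \in J & G \subset Z :|: F) ->
    face (bdry d [set Z :|: F | F in J]) G.
Proof.
move=> hZ dE; have FZ F : cell a b F -> forall x, x \in F -> x \notin Z.
  move=> cF x /(cell_bounds cF)/andP[ax _]; apply/negP => /hZ.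
  by rewrite ltnNge ax.
have cZF F : cell a b F -> #|Z :|: F| = d.+1.
  move=> cF; have [_ nF _ _] := cellP cF; rewrite cardsU dE nF.
  suff -> : Z :&: F = set0 by rewrite cards0 subn0.
  apply/setP => x; rewrite !inE; apply/negbTE/negP => /andP[xZ xF].
  by have := FZ _ cF _ xF; rewrite xZ.
have [j] := ubnP #|J|; elim: j J => // j IH J Jj lJ J0 Jk.
have [F [FJ lJF lastF]] := lower_last lJ J0.
have [Jc Jl] := lJ; have cF := Jc _ FJ; have [pF nF _ _] := cellP cF.
set H := Z :|: F; have cH : #|H| = d.+1 := cZF _ cF.
have kd : k < d.+1 by apply: leq_ltn_trans (Jk _ FJ); rewrite leq_addr.
have [JF0|JF0] := eqVneq (J :\ F) set0.
  have -> : J = [set F] by rewrite -(setD1K FJ) JF0 setU0.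
  rewrite imset_set1 -/H bdry1 //; split; first exact: FlipSimplex.
  move=> G Gk [_ /set1P-> GH].
  have : G \proper H by rewrite properEcard GH cH (leq_ltn_trans Gk).
  case/properP => _ [h hH hG]; apply/faceP; exists (H :\ h).
    by apply/imsetP; exists h.
  by apply/subsetP => x xG; rewrite in_setD1 (subsetP GH) // andbT; apply: contraNneq hG => <-.
have [||s f] := IH (J :\ F) _ lJF JF0.
- by move: Jj; rewrite (cardsD1 F) FJ.
- by move=> G /setD1P[_ /Jk].
set X := [set Z :|: F | F in J :\ F] in s f.
have TF : dtops a F \subset F.
  by apply/subsetP => x; rewrite !inE => /andP[/andP[]].
have TH : dtops a F \subset H by apply: subset_trans TF (subsetUr _ _).
(* Here [dtops a F] acts as the restriction face: cells containing it lie above [F], and [F] is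
   last. *)
have sub_last G : G \in J -> dtops a F \subset G -> G = F.
  by move=> GJ sG; apply: lastF => //; exact: dtops_below cF (Jc _ GJ) sG.
have T0 : dtops a F != set0.
  have [G /setD1P[nGF GJ]] := set0Pn _ JF0.
  by apply: contra nGF => /eqP T0; rewrite (sub_last G) // T0 sub0set.
have HX : H \notin X.
  apply/imsetP => -[G /setD1P[nGF GJ] /apex_inj e].
  by case/eqP: nGF; rewrite e //; apply: FZ => //; exact: Jc.
have -> : [set Z :|: F | F in J] = toggle X H.
  by rewrite toggle_notin // -imsetU1 setD1K.
have crd t : t \in F -> #|H :\ t| = d.
  by move=> tF; apply: card_ridge cH _; rewrite inE tF orbT.
have TnH : dtops a F != H.
  by apply: contraTneq (Jk _ FJ) => ->; rewrite cH -leqNgt leq_addl.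
have [||s' f'] := bdry_step s cH TH T0 TnH.
- move=> t tT; have tF := subsetP TF _ tT.
  (* The neighbour of [F] across [F :\ t] is below [F], hence already in [J], and by
     [cell_completion] no third cell contains this ridge. *)
  have [x [xF xt _ cG]] := cell_swap cF tT; set G := x |: F :\ t in cG.
  have nGF : G != F.
    apply/eqP => e; have : x \in G by rewrite setU11.
    by rewrite e (negPf xF).
  have GJ : G \in J by apply: Jl FJ cG _; exact: below_swap.
  apply: (@bdry_unique _ _ _ _ (Z :|: G)).
  + exact: crd.
  + by apply/imsetP; exists G => //; rewrite in_setD1 nGF.
  + apply/subsetP => y; rewrite !inE => /andP[-> /orP[->|->]] //.
    by rewrite !orbT.
  + move=> _ /imsetP[K /setD1P[nKF KJ] ->] sK; congr (_ :|: _).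
    have s1 : F :\ t \subset K.
      rewrite -(@apex_sub Z); last by move=> y /setD1P[_ /(FZ _ cF)].
      by apply: subset_trans sK; apply: setSD; exact: subsetUr.
    by apply: (cell_completion cF (Jc _ KJ) cG tF); rewrite ?subsetU1 // subsetUr.
- apply/negP => /faceP[r rX Tr]; have [_ /imsetP[G /setD1P[nGF GJ] ->] rG] := bdry_sub rX.
  case/eqP: nGF; apply: sub_last => //.
  rewrite -(@apex_sub Z); first exact: subset_trans Tr rG.
  by move=> y /(subsetP TF) /(FZ _ cF).
split => // G Gk [K KJ GK]; rewrite f'; apply/andP; split.
  have [e|nKF] := eqVneq K F; first by move: GK; rewrite e => ->; rewrite orbT.
  by rewrite f //; exists K; rewrite // in_setD1 nKF.
(* The face that disappears has [d.+1 - #|dtops a F|] elements, which is more than [k]. *)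
apply/negP => /subset_leq_card; rewrite cardsD (setIidPr TH) cH.
by move: (Jk _ FJ) Gk; clear; lia.
Qed.

End Build.

(** * Even [d]: replacing a relative squeezed ball by a cone from [w] *)

Section Sewing.
Variables (n m : nat).
Hypothesis m0 : 0 < m.
Hypothesis mn : m.*2 <= n.
Local Notation T := 'I_n.+2.
Local Notation cell := (@cell n.+2 m).
Local Notation dtops := (@dtops n.+2).
Local Notation d := m.*2.
Implicit Types (F G : {set T}) (J D I : {set {set T}}).

Let w : T := ord_max.
Let o : T := ord0.

Let cnt1 F : cnt F 1 = (o \in F).
Proof. by rewrite cntS cnt0 -nmemE. Qed.

(* A 2m-ball with boundary the cyclic polytope on all vertices but w. *)
Definition apexed : {set {set T}} := [set [set o] :|: F | F in [set F | cell 1 n.+1 F]].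
(** In the boundary modulo 2, the cones from [w] delete the cells of [D] and insert the cone over
    the boundary of [D]. *)
Definition sewn D : {set {set T}} := apexed :|: [set w |: F | F in D].
Definition cells D := forall F, F \in D -> cell 0 n.+1 F.

Let wF F : cell 0 n.+1 F -> w \notin F.
Proof. by move=> cF; apply/negP => /(cell_bounds cF); rewrite /= ltnn. Qed.

Let w_apexed H : H \in apexed -> w \notin H.
Proof.
case/imsetP => F; rewrite inE => cF ->; rewrite !inE negb_or -val_eqE /=.
by apply: wF; exact: cell_weaken cF.
Qed.

Let wF_eq F G : cell 0 n.+1 F -> cell 0 n.+1 G -> w |: F = w |: G -> F = G.
Proof.
by move=> /wF wF' /wF wG e; rewrite -(setU1K wF') -(setU1K wG) e.
Qed.

Let card_wF F : cell 0 n.+1 F -> #|w |: F| = d.+1.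
Proof. by move=> cF; have [_ nF _ _] := cellP cF; rewrite cardsU1 (wF cF) nF. Qed.

Let mem_sewn D F : cells D -> cell 0 n.+1 F -> (w |: F \in sewn D) = (F \in D).
Proof.
move=> cD cF; rewrite inE; apply/orP/idP => [[/w_apexed|/imsetP[G GD e]]|FD].
- by rewrite setU11.
- by rewrite (wF_eq cF (cD _ GD) e).
- by right; apply/imsetP; exists F.
Qed.

Let sewnU1 D F : sewn (F |: D) = (w |: F) |: sewn D.
Proof. by rewrite /sewn imsetU1 setUCA. Qed.

Let sewnD1 D F : cells D -> F \in D -> sewn (D :\ F) = sewn D :\ (w |: F).
Proof.
move=> cD FD; rewrite -{2}(setD1K FD) sewnU1 setU1K // mem_sewn ?setD11 //.
  by move=> G /setD1P[_ /cD].
exact: cD.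
Qed.

Let sewn_w D K : K \in sewn D -> w \in K -> exists2 G, G \in D & K = w |: G.
Proof. by rewrite inE => /orP[/w_apexed/negPf->|/imsetP[G GD ->]] //; exists G. Qed.

Let sub_wF F G : w \notin F -> (F \subset w |: G) = (F \subset G).
Proof.
move=> wF'; apply: apex_sub => x xF; rewrite inE.
by apply: contraNneq wF' => <-.
Qed.

(** Exactly one simplex of [apexed] contains [F]: the cone over [F] if 0 is not in [F], and
    otherwise the cone over the cell obtained by raising 0 to the first gap. *)
Lemma apexed_facet F : cell 0 n.+1 F -> F \in bdry d apexed.
Proof.
move=> cF; have [pF nF _ Fb] := cellP cF.
have cell1 G : cell 1 n.+1 G -> o \notin G.
  by move=> cG; apply/negP => /(cell_bounds cG).
have oG (K G : {set T}) : cell 1 n.+1 G -> K \subset [set o] :|: G -> K :\ o \subset G.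
  by move=> cG; rewrite subDset.
case: (boolP (o \in F)) => oF.
  have [|x xF cG] := @cell_raise _ _ _ F o cF oF erefl; first by rewrite ltnS mn leqnSn.
  apply: (@bdry_unique _ _ _ _ ([set o] :|: (x |: F :\ o))).
  - by [].
  - by apply/imsetP; exists (x |: F :\ o); rewrite ?inE.
  - by rewrite setUCA setD1K // subsetU1.
  - move=> K' /imsetP[G]; rewrite inE => cG' -> FG; congr (_ :|: _).
    have nGF K : cell 1 n.+1 K -> K != F.
      by move=> /cell1; apply: contraNneq => ->.
    have cw K : cell 1 n.+1 K -> cell 0 n.+1 K by exact: cell_weaken.
    apply: (cell_completion cF (cw _ cG') (cw _ cG) oF).
    + exact: nGF.
    + exact: nGF.
    + exact: oG.
    + exact: subsetU1.
have cF1 : cell 1 n.+1 F by apply: cell_pos => //; rewrite -[0]/(val o) nmemE.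
apply: (@bdry_unique _ _ _ _ ([set o] :|: F)); rewrite ?subsetUr //.
  by apply/imsetP; exists F; rewrite ?inE.
move=> K' /imsetP[G]; rewrite inE => cG -> FG; congr (_ :|: _).
have [_ nG _ _] := cellP cG; apply/eqP; rewrite eq_sym eqEcard nF nG leqnn andbT.
rewrite -(@apex_sub _ [set o]) // => x xF; rewrite inE.
by apply: contraNneq oF => <-.
Qed.

(** Among the cones from [w] only [w |: F] can contain [F], so the parity inherited from [apexed] is
    reversed exactly when [F] is in [D]. *)
Lemma sewn_facet D F : cells D -> cell 0 n.+1 F ->
  (F \in bdry d (sewn D)) = (F \notin D).
Proof.
move=> cD cF; have := apexed_facet cF; rewrite !mem_bdry => /andP[-> oA] /=.
have -> : [set H in sewn D | F \subset H] =
    [set H in apexed | F \subset H] :|: [set H in [set w |: F] | F \in D].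
  apply/setP => H; rewrite !inE; case: (H \in apexed) => //=.
    by case: eqP => [->|_]; rewrite ?orbF ?subsetUr //=; case: (F \in D).
  apply/andP/andP => [[/imsetP[G GD ->]]|[/eqP-> FD]]; last first.
    by rewrite subsetUr; split => //; apply/imsetP; exists F.
  rewrite sub_wF ?wF // => sFG; have [_ nF _ _] := cellP cF.
  have [_ nG _ _] := cellP (cD _ GD).
  have -> : F = G by apply/eqP; rewrite eqEcard sFG nF nG leqnn.
  by rewrite eqxx GD.
case: (boolP (F \in D)) => FD; last first.
  rewrite (_ : [set H in [set w |: F] | false] = set0) ?setU0 //.
  by apply/setP => H; rewrite !inE andbF.
rewrite (_ : [set H in [set w |: F] | true] = [set w |: F]); last first.
  by apply/setP => H; rewrite !inE andbT.
rewrite setUC cardsU1 oddD oA inE.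
suff -> : w |: F \in apexed = false by [].
by apply/negP => /w_apexed; rewrite setU11.
Qed.

(** The simplex [w |: F] is glued along [F] and along its facets opposite [dtops 0 F], which by
    hypothesis belong to earlier cones. The face that appears is [w |: dtops 0 F]. *)
Lemma sew D F : cells D -> cell 0 n.+1 F -> F \notin D -> flip_sphere d (bdry d (sewn D)) ->
  (forall t, t \in dtops 0 F -> exists2 G, G \in D & F :\ t \subset G) ->
  (forall G, G \in D -> ~~ (dtops 0 F \subset G)) ->
  flip_sphere d (bdry d (sewn (F |: D))) /\
  forall K, face (bdry d (sewn (F |: D))) K =
    (face (bdry d (sewn D)) K || (K \subset w |: F)) && ~~ (F :\: dtops 0 F \subset K).
Proof.
move=> cD cF FD sD s1 s2; have wF' := wF cF; have [_ nF _ _] := cellP cF.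
have TF : dtops 0 F \subset F by apply/subsetP => x; rewrite !inE => /andP[/andP[]].
have -> : F :\: dtops 0 F = (w |: F) :\: (w |: dtops 0 F).
  apply/setP => x; rewrite !inE; case: eqP => [->|] //=.
  by rewrite (negPf wF') andbF.
rewrite sewnU1 -toggle_notin ?mem_sewn //; apply: bdry_step => //.
- exact: card_wF.
- exact: setUS.
- by apply/set0Pn; exists w; rewrite setU11.
- apply/eqP => e; have wT : w \notin dtops 0 F by apply: contra wF'; exact: (subsetP TF).
  have : #|w |: dtops 0 F| = d.+1 by rewrite e card_wF.
  rewrite cardsU1 wT add1n => -[cT].
  have : #|dtops 0 F| <= #|tops F|.
    by apply: subset_leq_card; apply/subsetP => x; rewrite inE => /andP[].
  by rewrite card_tops nF doubleK cT; move: m0; clear; lia.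
- move=> t; rewrite in_setU1 => /orP[/eqP->|tT].
    by rewrite setU1K // sewn_facet.
  have tF := subsetP TF _ tT; have [G GD sG] := s1 t tT.
  have ntw : t != w by apply: contraNneq wF' => <-.
  have wH : w \in (w |: F) :\ t by rewrite !inE eqxx eq_sym ntw.
  have sE K : cell 0 n.+1 K -> ((w |: F) :\ t \subset w |: K) -> F :\ t \subset K.
    move=> cK s; rewrite -sub_wF; first by apply: subset_trans s; rewrite setSD ?subsetUr.
    by rewrite inE (negPf wF') andbF.
  apply: (@bdry_unique _ _ _ _ (w |: G)).
  + by apply: card_ridge (card_wF cF) _; rewrite inE tF orbT.
  + by rewrite mem_sewn //; exact: cD.
  + by rewrite setDUl; apply: setUSS => //; exact: subD1set.
  + move=> K KD sK; have [L LD eK] := sewn_w KD (subsetP sK _ wH).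
    rewrite eK in sK *; congr (_ |: _).
    have nF' M : M \in D -> M != F by apply: contraTneq => ->.
    by apply: (cell_completion cF (cD _ LD) (cD _ GD) tF); rewrite ?nF' // sE //; exact: cD.
- apply/negP => /faceP[r rX Tr]; have [K KD rK] := bdry_sub rX.
  have wr : w \in r by apply: (subsetP Tr); rewrite setU11.
  have [G GD eK] := sewn_w KD (subsetP rK _ wr).
  case/negP: (s2 _ GD); rewrite -sub_wF; last by apply: contra wF'; exact: (subsetP TF).
  by rewrite -eK; apply: subset_trans rK; apply: subset_trans Tr; exact: subsetUr.
Qed.

(** No other cone contains the facets of [w |: F] opposite [tops F], so these are in the boundary.
    Taking the simplex away makes [tops F] appear. *)
Lemma unsew D F : cells D -> F \in D -> flip_sphere d (bdry d (sewn D)) ->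
  (forall G t, G \in D -> t \in tops F -> F :\ t \subset G -> G = F) ->
  ~~ face (bdry d (sewn D)) (tops F) ->
  flip_sphere d (bdry d (sewn (D :\ F))) /\
  forall K, face (bdry d (sewn (D :\ F))) K =
    (face (bdry d (sewn D)) K || (K \subset w |: F)) && ~~ (w |: (F :\: tops F) \subset K).
Proof.
move=> cD FD sD s1 s2; have cF := cD _ FD; have wF' := wF cF; have [_ nF _ _] := cellP cF.
have TF : tops F \subset F by apply/subsetP => x; rewrite inE => /andP[].
have cT : #|tops F| = m by rewrite card_tops nF doubleK.
have -> : w |: (F :\: tops F) = (w |: F) :\: tops F.
  apply/setP => x; rewrite !inE; case: eqP => [->|] //=.
  by rewrite (negPf wF').
rewrite sewnD1 // -toggle_in ?mem_sewn //; apply: bdry_step => //.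
- exact: card_wF.
- by apply: subset_trans TF (subsetUr _ _).
- by rewrite -card_gt0 cT.
- by apply/eqP => /(congr1 (fun A : {set T} => #|A|)); rewrite cT card_wF //; move: m0; clear; lia.
- move=> t tT; have tF := subsetP TF _ tT.
  have ntw : t != w by apply: contraNneq wF' => <-.
  have wH : w \in (w |: F) :\ t by rewrite !inE eqxx eq_sym ntw.
  apply: (@bdry_unique _ _ _ _ (w |: F)).
  + by apply: card_ridge (card_wF cF) _; rewrite inE tF orbT.
  + by rewrite mem_sewn.
  + exact: subD1set.
  + move=> K KD sK; have [L LD eK] := sewn_w KD (subsetP sK _ wH).
    rewrite eK in sK *; congr (_ |: _); apply: s1 LD tT _.
    rewrite -sub_wF; first by apply: subset_trans sK; rewrite setSD ?subsetUr.
    by rewrite inE (negPf wF') andbF.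
Qed.

Definition zcells := [set F : {set T} | cell 0 n.+1 F & o \in F].
Definition shadow I := (zcells :|: [set up F | F in I]) :\: I.

Let small_faces D := forall K : {set T}, #|K| <= m -> face (bdry d (sewn D)) K.

Lemma sewn_zcells : flip_sphere d (bdry d (sewn zcells)) /\ small_faces zcells.
Proof.
have lz : lower m 0 n.+1 zcells.
  split=> [F|F G]; rewrite !inE => /andP[cF oF] //.
  by move=> cG /(_ 1); rewrite !cnt1 cG oF; case: (o \in G).
(* The cells through 0 are sewn on in increasing order, so the claim is generalised to lower sets
   [D] and to small sets already contained in some simplex of the ball. *)
suff main D : lower m 0 n.+1 D -> D \subset zcells ->
    flip_sphere d (bdry d (sewn D)) /\
    forall K : {set T}, #|K| <= m -> (exists2 H, H \in sewn D & K \subset H) -> face (bdry d (sewn D)) K.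
  have [s f] := main _ lz (subxx _); split => // K cK; apply: f => //.
  case: (boolP (w \in K)) => wK.
    (* Vertex 0 takes the place of [w] in the set to be covered, which forces the covering cell into
       [zcells]. *)
    have [||||F cF sF] := @cell_cover n.+2 m 0 n.+1 (o |: K :\ w).
    - rewrite cardsU1 (leq_trans _ cK) // (cardsD1 w K) wK leq_add2r.
      by case: (_ \notin _).
    - by rewrite add0n ltnW.
    - by [].
    - move=> x; rewrite !inE /= => /orP[/eqP->//|/andP[nxw _]].
      by have := ltn_ord x; rewrite ltnS leq_eqVlt -[n.+1]/(val w) val_eqE (negPf nxw).
    exists (w |: F).
      rewrite mem_sewn // ?inE ?cF ?(subsetP sF) ?setU11 //.
      by move=> G; rewrite inE => /andP[].
    rewrite -(setD1K wK) setUS //; apply: subset_trans sF; exact: subsetUr.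
  have [||||F cF sF] := @cell_cover n.+2 m 1 n.+1 (K :\ o).
  - by apply: leq_trans cK; apply: subset_leq_card; exact: subD1set.
  - by rewrite add1n.
  - by [].
  - move=> x; rewrite !inE lt0n => /andP[nxo xK]; rewrite -[0]/(val o) val_eqE nxo /=.
    have nxw : x != w by apply: contraNneq wK => <-.
    by have := ltn_ord x; rewrite ltnS leq_eqVlt -[n.+1]/(val w) val_eqE (negPf nxw).
  exists ([set o] :|: F); last by rewrite -subDset.
  by rewrite inE; apply/orP; left; apply/imsetP; exists F; rewrite ?inE.
have [j] := ubnP #|D|; elim: j D => // j IH D Dj lD Dz.
have [->|D0] := eqVneq D set0.
  rewrite /sewn imset0 setU0.
  have cov1 : [set F : {set T} | cell 1 n.+1 F] != set0.
    have [||||F cF _] := @cell_cover n.+2 m 1 n.+1 set0; rewrite ?cards0 ?add1n //.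
    - by move=> x; rewrite inE.
    - by apply/set0Pn; exists F; rewrite inE.
  have [|||F|s f] := @build n.+2 m [set o] 1 n.+1 d m _ _ _ _ cov1.
  - by move=> z /set1P->.
  - by rewrite cards1 add1n.
  - by split=> [F|F G]; rewrite !inE.
  - rewrite inE => /cellP[_ nF _ _].
    have : #|dtops 1 F| <= #|tops F|.
      by apply: subset_leq_card; apply/subsetP => x; rewrite inE => /andP[].
    by rewrite card_tops nF doubleK; clear; lia.
  split => // K cK [H /imsetP[F FJ ->] KH]; apply: f => //; by exists F.
have [F [FD lDF lastF]] := lower_last lD D0; have [cD lD2] := lD.
have cF := cD _ FD; have [_ nF _ _] := cellP cF.
have oF : o \in F by have := subsetP Dz _ FD; rewrite inE => /andP[].
have TF : dtops 0 F \subset F by apply/subsetP => x; rewrite !inE => /andP[/andP[]].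
have [|s f] := IH (D :\ F) _ lDF (subset_trans (subD1set _ _) Dz).
  by move: Dj; rewrite (cardsD1 F) FD.
have [|||s' f'] := @sew (D :\ F) F lDF.1 cF _ s; rewrite ?setD11 //.
- move=> t tT; have [x [xF xt _ cG]] := cell_swap cF tT.
  have tF := subsetP TF _ tT.
  exists (x |: F :\ t); last exact: subsetU1.
  rewrite in_setD1 (lD2 _ _ FD cG (below_swap tF xF xt)) andbT.
  by apply: contraNneq xF => <-; rewrite setU11.
- move=> G /setD1P[nGF GD]; apply: contra nGF => sG; apply/eqP; apply: lastF => //.
  exact: dtops_below cF (cD _ GD) sG.
rewrite setD1K // in s' f'; split => // K cK [H HD KH]; rewrite f'; apply/andP; split.
  have [e|nH] := eqVneq H (w |: F); first by move: KH; rewrite e => ->; rewrite orbT.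
  by rewrite f //; exists H; rewrite ?sewnD1 // in_setD1 nH.
(* By [card_dtops0] the face that disappears has more than [m] elements. *)
apply/negP => /subset_leq_card; rewrite cardsD (setIidPr TF) nF.
have F0 : nmem F 0 by move: oF; rewrite -nmemE.
by move: (card_dtops0 m0 cF F0) cK; clear; lia.
Qed.

(** When the last cell [F] joins the lower set, the shadow gains [U = up F] and loses [F]: one [sew]
    followed by one [unsew]. *)
Lemma sewn_shadow I : lower m 0 n I ->
  flip_sphere d (bdry d (sewn (shadow I))) /\ small_faces (shadow I).
Proof.
have [j] := ubnP #|I|; elim: j I => // j IH I Ij lI.
have [->|I0] := eqVneq I set0.
  by rewrite /shadow imset0 setU0 setD0; exact: sewn_zcells.
have [F [FI lI' lastF]] := lower_last lI I0; set I' := I :\ F in lI'.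
have [cI lI2] := lI; have [cI' lI2'] := lI'.
have cF := cI _ FI; have [_ nF _ _] := cellP cF.
have nn2 : n < n.+2 by [].
have Ij' : #|I'| < j by move: Ij; rewrite (cardsD1 F) FI.
have [s f] := IH I' Ij' lI'.
have FI' : F \notin I' by rewrite setD11.
set U := up F; have cU1 : cell 1 n.+1 U := cell_up nn2 cF.
have cU : cell 0 n.+1 U by exact: cell_weaken cU1.
have cF' : cell 0 n.+1 F by exact: cell_weaken cF.
have oU : o \notin U by apply/negP => /(cell_bounds cU1).
have bFU : below F U := below_up nn2 cF.
have cntU k : cnt U k.+1 = cnt F k := cnt_up_cell k nn2 cF.
have FU : U <> F.
  move=> e; have z k : cnt F k = 0.
    by elim: k => [|k IHk]; [exact: cnt0 | rewrite -[in LHS]e cntU].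
  by have := z n.+2; rewrite cntn nF; move: m0; clear; lia.
have below_cell G : cell 0 n.+1 G -> below G F -> cell 0 n G.
  move=> cG /(_ n); have [_ _ _ ->] := cellP cF; have [pG nG _ _] := cellP cG => le.
  apply: cellI => // x xG; apply: cnt_full xG.
  by apply/eqP; rewrite eqn_leq cnt_card nG le.
have inI G : cell 0 n.+1 G -> below G F -> G \in I.
  by move=> cG GF; exact: lI2 FI (below_cell _ cG GF) GF.
have inI' G : cell 0 n.+1 G -> below G F -> G != F -> G \in I'.
  by move=> cG GF nGF; rewrite in_setD1 nGF inI.
have up_inj G : G \in I -> up G = U -> G = F.
  move=> GI e; apply: cnt_inj => k.
  by rewrite -cntU -e (cnt_up_cell k nn2 (cI _ GI)).
have UI' : U \notin I'.
  by apply: contra FI' => UI; exact: lI2' UI cF bFU.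
have US : U \notin shadow I'.
  rewrite in_setD in_setU [U \in zcells]inE (negPf oU) andbF UI' /=.
  apply/imsetP => -[G GI' /esym e]; have := up_inj G _ e.
  by move: GI'; rewrite in_setD1 => /andP[nG GI] /(_ GI) eG; rewrite eG eqxx in nG.
have cS J : (forall G, G \in J -> cell 0 n G) -> cells (shadow J).
  move=> cJ G; rewrite !inE => /andP[_ /orP[/andP[]//|/imsetP[K /cJ cK ->]]].
  exact: cell_weaken (cell_up nn2 cK).
have dU : dtops 0 U = tops U.
  by apply: dtops_tops => x /(cell_bounds cU1)/andP[].
have [||s1 f1] := sew (cS _ cI') cU US s.
- move=> t tT; have [x [xU xt btw cG]] := cell_swap cU tT.
  have tU : t \in U by move: tT; rewrite !inE => /andP[/andP[]].
  set G := x |: U :\ t in cG; exists G; last exact: subsetU1.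
  have GU : below G U := below_swap tU xU xt.
  have nGU : G != U by apply: contraNneq xU => <-; rewrite setU11.
  rewrite in_setD; apply/andP; split.
    (* The jump from [t] to [x] raises a count by one only where [U] has a member, so the counts of
       [G] stay below those of [U] shifted by one, which are the counts of [F]. Thus [F] is below
       [G], and [G] in [I'] would put [F] in [I']. *)
    apply/negP => GI'; case/negP: FI'; apply: lI2' GI' cF _ => k.
    have := cnt_swap k tU xU; rewrite -/G -cntU cntS.
    case: (ltnP x k) => xk /=; last by rewrite addn0; clear; lia.
    case: (ltnP t k) => tk /=; first by clear; lia.
    have kn : k < n.+2 by apply: leq_ltn_trans tk (ltn_ord t).
    suff -> : nmem U k by clear; lia.
    rewrite (nmem_ord _ kn); have [et|nt] := eqVneq (Ordinal kn) t; first by rewrite et.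
    by apply: btw => //=; rewrite ltn_neqAle tk andbT -val_eqE in nt *.
  rewrite in_setU inE cG /=; case: (boolP (o \in G)) => //= oG.
  (* A cell [G] avoiding 0 is the translate of [dn G], which lies strictly below [F] and so belongs
     to [I']. *)
  have oG' : ~~ nmem G 0 by move: oG; rewrite -nmemE.
  have cG1 := cell_pos cG oG'.
  apply/imsetP; exists (dn G); last by rewrite dnK.
  apply: inI'; first exact: cell_weaken (cell_dn cG1).
    by move=> k; rewrite cnt_dn // -cntU.
  by apply: contraNneq nGU => e; rewrite -(dnK oG') e.
- move=> G; rewrite in_setD => /andP[_ GJ]; apply/negP => sG.
  have cG : cell 0 n.+1 G.
    move: GJ; rewrite !inE => /orP[/andP[]//|/imsetP[K /cI' cK ->]].
    exact: cell_weaken (cell_up nn2 cK).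
  (* A cell containing [dtops 0 U] is above [U], so it avoids 0. If it is [up K] with [K] in [I'],
     then [K] is above [F], which would put [F] in [I']. *)
  have UG := dtops_below cU cG sG; move: GJ; rewrite !inE => /orP[/andP[_ oG]|].
    by have := UG 1; rewrite !cnt1 oG (negPf oU).
  case/imsetP=> K KI' eG; case/negP: FI'; apply: (lI2' _ _ KI' cF) => k.
  by rewrite -cntU -(cnt_up_cell k nn2 (cI' _ KI')) -eG.
have FS : F \in U |: shadow I'.
  rewrite in_setU1 in_setD FI' in_setU inE cF' /=; apply/orP; right.
  case: (boolP (o \in F)) => //= oF.
  have oF' : ~~ nmem F 0 by move: oF; rewrite -nmemE.
  have cF1 := cell_pos cF' oF'.
  apply/imsetP; exists (dn F); last by rewrite dnK.
  apply: inI'; [exact: cell_weaken (cell_dn cF1) | exact: below_dn|].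
  by apply/eqP => e; apply: FU; rewrite /U -{1}e dnK.
have cUS : cells (U |: shadow I').
  by move=> G /setU1P[->//|]; apply: cS; exact: cI'.
have sBT : U :\: dtops 0 U \subset tops F by rewrite dU; exact: bottoms_up cF.
have [||s2 f2] := unsew cUS FS s1.
(* Such a [G] would be strictly below [F], hence in [I'], while neither [U] nor a cell of the shadow
   is in [I']. *)
- move=> G t GS tT sG; apply/eqP/negPn/negP => nGF.
  have cG := cUS _ GS; have GF := tops_completion cF' cG tT nGF sG.
  have GI' := inI' _ cG GF nGF.
  move: GS; rewrite in_setU1 in_setD GI' /= orbF => /eqP eG.
  by rewrite -eG GI' in UI'.
(* Sewing on [U] has just destroyed its set of lower elements, which is contained in [tops F]. *)
- by rewrite f1 sBT andbF.
have eS : shadow I = (U |: shadow I') :\ F.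
  apply/setP => G; rewrite !inE; have [->|nGF] := eqVneq G F; first by rewrite FI.
  rewrite /=; have [->|nGU] := eqVneq G U.
    rewrite imset_f // orbT andbT; apply: contra UI' => UI; rewrite in_setD1 UI andbT.
    exact/eqP.
  congr (_ && (_ || _)); apply/imsetP/imsetP => -[K KI eK]; exists K => //.
    by rewrite in_setD1 KI andbT; apply: contraNneq nGU => e; rewrite eK e.
  by move: KI => /setD1P[].
rewrite eS; split => // K cK; rewrite f2; apply/andP; split; last first.
  (* The face destroyed by [unsew] consists of [w] and [m] lower elements, one too many to
     matter. *)
  apply/negP => /subset_leq_card; rewrite cardsU1 cardsD.
  have TF : tops F \subset F by apply/subsetP => x; rewrite inE => /andP[].
  rewrite (setIidPr TF) card_tops nF doubleK in_setD (negPf (wF cF')) andbF /=.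
  by rewrite -addnn addnK add1n ltnNge cK.
rewrite f1; case: (boolP (U :\: dtops 0 U \subset K)) => [sK|_]; last first.
  by rewrite f.
(* The only small face lost in sewing is the set of lower elements of [U]; it is contained in
   [w |: F], so removing that simplex restores it. *)
apply/orP; right.
have TF : tops F \subset F by apply/subsetP => x; rewrite inE => /andP[].
suff <- : U :\: dtops 0 U = K.
  by apply: subset_trans (subset_trans sBT TF) (subsetUr _ _).
apply/eqP; rewrite eqEcard sK dU cardsD.
have TU : tops U \subset U by apply/subsetP => x; rewrite inE => /andP[].
have [_ nU _ _] := cellP cU.
by rewrite (setIidPr TU) card_tops nU doubleK -addnn addnK.
Qed.

(** Having [m.*2] elements, [F] is a face only as a facet, that is, when it is outside the shadow.
    If [F] is not in [I], then [dn F], being strictly below [F], is in [I], and [F] is its translate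
    in the shadow. *)
Lemma shadow_facet I F : lower m 0 n I -> cell 0 n F -> o \notin F ->
  (forall G, cell 0 n G -> below G F -> G != F -> G \in I) ->
  face (bdry d (sewn (shadow I))) F = (F \in I).
Proof.
move=> lI cF oF sub; have cF' : cell 0 n.+1 F by exact: cell_weaken cF.
have [_ nF _ _] := cellP cF.
have cS : cells (shadow I).
  move=> G; rewrite !inE => /andP[_ /orP[/andP[]//|/imsetP[K /(lI.1) cK ->]]].
  exact: cell_weaken (cell_up (ltnW (ltnSn _)) cK).
have -> : face (bdry d (sewn (shadow I))) F = (F \in bdry d (sewn (shadow I))).
  apply/faceP/idP => [[r rX Fr]|Fb]; last by exists F.
  suff -> : F = r by [].
  apply/eqP; rewrite eqEcard Fr nF; move: rX; rewrite mem_bdry => /andP[/eqP-> _].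
  by rewrite leqnn.
rewrite sewn_facet // in_setD negb_and negbK; case: (boolP (F \in I)) => //= FI.
apply/negbTE; rewrite negbK in_setU; apply/orP; right.
have oF' : ~~ nmem F 0 by move: oF; rewrite -nmemE.
have cF1 := cell_pos cF' oF'.
apply/imsetP; exists (dn F); last by rewrite dnK.
apply: sub; [exact: cell_dn cF1 | exact: below_dn |].
apply/eqP => e; have z k : cnt F k = 0.
  by elim: k => [|k IHk]; [exact: cnt0 | rewrite -cnt_dn // e].
by have := z n.+2; rewrite cntn nF; move: m0; clear; lia.
Qed.

End Sewing.

(** * Odd [d]: boundaries of squeezed balls *)

Section OddSphere.
Variables (n m : nat).
Hypothesis m0 : 0 < m.
Hypothesis mn : m.*2 <= n.
Local Notation cell := (@cell n m).
Local Notation d := (m.*2.-1).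
Implicit Types (F G : {set 'I_n}) (J : {set {set 'I_n}}).

Let dE : d.+1 = m.*2. Proof. by rewrite prednK // double_gt0. Qed.

Lemma squeezed_sphere J : lower m 0 n J -> (forall F, cell 0 n F -> nmem F 0 -> F \in J) ->
  flip_sphere d (bdry d J) /\ forall K : {set 'I_n}, #|K| <= m.-1 -> face (bdry d J) K.
Proof.
move=> lJ zJ.
have n0 : 0 < n by apply: leq_trans mn; rewrite double_gt0.
set o := Ordinal n0.
(* Adjoining vertex 0 to [K] makes the covering cell a member of [J]; this costs one element, whence
   the bound [m.-1]. *)
have cover (K : {set 'I_n}) : #|K| <= m.-1 -> exists2 F, F \in J & K \subset F.
  move=> cK; have [||||F cF sF] := @cell_cover n m 0 n (o |: K).
  - by rewrite cardsU1 -(prednK m0); case: (_ \notin _) => //=; exact: leqW.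
  - by rewrite add0n.
  - by [].
  - by move=> x _; rewrite ltn_ord.
  exists F; last by apply: subset_trans sF; exact: subsetUr.
  by apply: zJ => //; rewrite (nmem_ord _ n0) (subsetP sF) // setU11.
have J0 : J != set0.
  by have [|F FJ _] := cover set0; [rewrite cards0 | apply/set0Pn; exists F].
have eJ : [set set0 :|: F | F in J] = J.
  by rewrite -[RHS]imset_id; apply: eq_imset => F; rewrite set0U.
have [||F FJ|s f] := @build n m set0 0 n d m.-1 J _ _ lJ J0.
- by move=> z; rewrite inE.
- by rewrite cards0 add0n.
- have [_ nF _ _] := cellP (lJ.1 _ FJ).
  have : #|dtops 0 F| <= #|tops F|.
    by apply: subset_leq_card; apply/subsetP => x; rewrite inE => /andP[].
  rewrite card_tops nF doubleK dE -addnn -{3}(prednK m0) addSn ltnS => le.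
  by rewrite leq_add2l.
rewrite eJ in s f; split => // K cK; apply: f => //.
by have [F FJ KF] := cover K cK; exists F => //; rewrite set0U.
Qed.

(** A cell of [J] containing [tops F] is above [F], which puts [F] in the lower set [J]. Conversely,
    if [F] is in [J], it is the only such cell, so a ridge of [F] opposite a lower element is in the
    boundary and contains [tops F]. *)
Lemma squeezed_face J F : lower m 0 n J -> cell 0 n F -> ~~ nmem F 0 ->
  (forall G, G \in J -> below F G -> G = F) -> face (bdry d J) (tops F) = (F \in J).
Proof.
move=> lJ cF F0 maxF; have [pF nF _ _] := cellP cF.
have n0 : 0 < n by apply: leq_trans mn; rewrite double_gt0.
have dT : dtops 0 F = tops F.
  apply: dtops_tops => x xF; rewrite lt0n; apply: contra F0 => /eqP x0.
  by rewrite -x0 nmemE.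
have up_F G : G \in J -> tops F \subset G -> below F G.
  by move=> GJ sG; apply: dtops_below cF (lJ.1 _ GJ) _; rewrite dT.
apply/faceP/idP => [[r rJ Tr]|FJ].
  have [G GJ rG] := bdry_sub rJ.
  by apply: (lJ.2 _ _ GJ cF); apply: up_F => //; exact: subset_trans Tr rG.
have TF : tops F \subset F by apply/subsetP => x; rewrite inE => /andP[].
have : tops F \proper F.
  by rewrite properEcard TF card_tops nF doubleK -addnn -[X in X < _]addn0 ltn_add2l.
case/properP => _ [l lF lT].
have Tl : tops F \subset F :\ l.
  by apply/subsetP => x xT; rewrite in_setD1 (subsetP TF) // andbT; apply: contraNneq lT => <-.
exists (F :\ l) => //; apply: (@bdry_unique _ _ _ _ F) => //.
- by apply: card_ridge lF; rewrite nF dE.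
- exact: subD1set.
- by move=> G GJ sG; apply: maxF => //; apply: up_F => //; exact: subset_trans sG.
Qed.

End OddSphere.

(** * Large antichains of cells and the lower sets they generate *)

Section Levels.
Variables (n m b : nat).
Implicit Types (F G : {set 'I_n}) (X : {set {set 'I_n}}).

(** Equal weight makes the cells pairwise incomparable. Avoiding vertex 0 is what [squeezed_face]
    and [shadow_facet] require. *)
Definition level s : {set {set 'I_n}} :=
  [set F | [&& cell m 0 b F, ~~ nmem F 0 & wgt F == s]].

(** Going down in the order increases the weight, so all heavier cells may be joined with any part
    of a level. *)
Definition over s X : {set {set 'I_n}} := [set G | cell m 0 b G & s < wgt G] :|: X.

Lemma lower_over s X : X \subset level s -> lower m 0 b (over s X).
Proof.
move=> XL; split=> [F|F G].
  rewrite !inE => /orP[/andP[]//|/(subsetP XL)].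
  by rewrite inE => /andP[].
rewrite !inE => FJ cG GF; rewrite cG /=; have [le _] := below_wgt GF.
case/orP: FJ => [/andP[_ /leq_trans ->]//|FX].
have : F \in level s := subsetP XL _ FX; rewrite inE => /and3P[_ _ /eqP eF].
move: le; rewrite eF leq_eqVlt => /orP[/eqP e|->//]; apply/orP; right.
by rewrite (@below_wgt_eq _ G F) // -e eF.
Qed.

Lemma lower_overz s X : X \subset level s ->
  lower m 0 b ([set G | cell m 0 b G & nmem G 0] :|: over s X).
Proof.
move=> XL; have [c l] := lower_over XL; split=> [F|F G].
  by rewrite in_setU inE => /orP[/andP[]//|/c].
case/setUP => FJ cG GF; apply/setUP; last by right; exact: l FJ cG GF.
left; move: FJ; rewrite !inE cG => /andP[_ F0] /=; have := GF 1.
by rewrite !cntS !cnt0 F0; case: (nmem G 0).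
Qed.

Lemma over_max s X F G : X \subset level s -> F \in level s -> G \in over s X ->
  below F G -> G = F.
Proof.
move=> XL; rewrite inE => /and3P[_ _ /eqP eF]; rewrite !inE => GJ FG.
have [le _] := below_wgt FG; case/orP: GJ => [/andP[_]|/(subsetP XL)].
  by rewrite -eF ltnNge le.
rewrite inE => /and3P[_ _ /eqP eG]; apply/esym/below_wgt_eq => //.
by rewrite eF eG.
Qed.

Lemma over_level s X F : X \subset level s -> F \in level s -> (F \in over s X) = (F \in X).
Proof.
by move=> XL; rewrite inE => /and3P[_ _ /eqP eF]; rewrite !inE eF ltnn andbF.
Qed.

Lemma wgt_bound F : cell m 0 b F -> wgt F <= n.+1 * m.*2.
Proof.
move=> cF; have [_ nF _ _] := cellP cF; rewrite -[X in X * _]card_ord -sum_nat_const.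
by apply: leq_sum => i _; rewrite -nF cnt_card.
Qed.

Variable h : nat.
Hypothesis hb : h.*2.+2 <= b.
Hypothesis bn : b <= n.
Implicit Types U : {set 'I_h}.

(** Each [u] becomes the pair of [2u+2] and [2u+3]. Vertices 0 and 1 stay free, and the largest
    vertex possible is [2h+1 < b]. *)
Definition dbl U : {set 'I_n} := [set x : 'I_n | (0 < x./2) && nmem U x./2.-1].

Lemma nmem_dbl U k : nmem (dbl U) k = (0 < k./2) && nmem U k./2.-1.
Proof.
case: (ltnP k n) => kn; first by rewrite (nmem_ord _ kn) inE.
rewrite nmem_ge // (@nmem_ge _ _ k./2.-1) ?andbF //.
by move: hb bn kn; clear; lia.
Qed.

Lemma cnt_dbl U j : cnt (dbl U) j.*2 = (cnt U j.-1).*2.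
Proof.
elim: j => [|j IH]; first by rewrite !cnt0.
rewrite doubleS !cntS IH !nmem_dbl /= uphalf_double doubleK.
case: j {IH} => [|j] //=; first by rewrite !addn0.
by rewrite cntS; case: (nmem U j); rewrite /= ?addn0 // !addn1 doubleS.
Qed.

Lemma cell_dbl U : #|U| = m -> cell m 0 b (dbl U).
Proof.
move=> cU; apply: cellI.
- apply/forallP => x; rewrite -nmemE; case: (boolP (nmem _ x)) => //= xU.
  rewrite -(odd_double_half x) in xU *; case: (odd x) xU => /=; rewrite ?add1n ?add0n.
    rewrite cntS cnt_dbl !nmem_dbl /= uphalf_double doubleK => /negPf ->.
    by rewrite addn0 odd_double.
  by rewrite cnt_dbl odd_double.
- rewrite -(@cnt_ge _ _ n.*2) ?cnt_dbl ?cnt_ge ?cU //; last by rewrite -addnn leq_addr.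
  by move: hb bn; clear; lia.
- move=> x; rewrite inE => /andP[_]; case: (ltnP x b) => //= bx.
  by rewrite nmem_ge //; move: hb bx; clear; lia.
Qed.

Lemma dbl_inj : injective dbl.
Proof.
move=> U V e; apply/setP => x; rewrite -!nmemE.
by have := nmem_dbl U x.+1.*2; rewrite e nmem_dbl doubleK.
Qed.

(** Pigeonhole: the [m]-subsets of ['I_h] give distinct cells through [dbl], distributed over the
    [(n.+1 * m.*2).+1] values allowed by [wgt_bound]. *)
Lemma big_level : exists s, 'C(h, m) <= #|level s| * (n.+1 * m.*2).+1.
Proof.
set M := n.+1 * m.*2.
have [s es] : {s : 'I_M.+1 | \max_(s < M.+1) #|level s| = #|level s|}.
  by apply: eq_bigmax; rewrite card_ord.
exists (nat_of_ord s); rewrite -es mulnC -[X in X * _]card_ord -sum_nat_const.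
apply: (@leq_trans (\sum_(s < M.+1) #|level s|)); last first.
  by apply: leq_sum => i _; apply: leq_bigmax.
have -> : 'C(h, m) = #|[set dbl U | U in [set U : {set 'I_h} | #|U| == m]]|.
  by rewrite (card_imset _ dbl_inj) card_draws card_ord.
apply: (@leq_trans #|\bigcup_(s < M.+1) level s|); last first.
  elim/big_rec2: _ => [|i x A _ le]; first by rewrite cards0.
  by apply: leq_trans (leq_card_setU _ _) _; rewrite leq_add2l.
apply/subset_leq_card/subsetP => K /imsetP[U]; rewrite inE => /eqP cU ->.
have cD := cell_dbl cU; have wM : wgt (dbl U) < M.+1 by rewrite ltnS wgt_bound.
apply/bigcupP; exists (Ordinal wM) => //; rewrite inE cD eqxx andbT nmem_dbl; by [].
Qed.

End Levels.

(** * Geometric realizations *)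

From mathcomp Require Import all_classical all_reals all_analysis.
Import Order.TTheory GRing.Theory Num.Theory.
Import numFieldNormedType.Exports.
Local Open Scope ring_scope.

Section Topology.
Variable R : realType.
Implicit Types n m : nat.

Lemma continuous_rV n m (f : 'rV[R]_n -> 'rV[R]_m) x :
  (forall j, {for x, continuous (fun y => f y ord0 j)}) -> {for x, continuous f}.
Proof.
move=> fc; apply/(@cvg_ballP _ _ _ _ (nbhs_filter x)) => e e0.
have : \forall y \near x, forall j, ball (f x ord0 j) e (f y ord0 j).
  by apply: (@filter_forall _ _ _ _ (nbhs_filter x)) => j; have /(@cvg_ballP _ _ _ _ (nbhs_filter x)) := fc j; apply.
by apply: (@filterS _ _ (nbhs_filter x)) => y h; split=> // i j; rewrite ord1.
Qed.

Lemma continuous_coord n (i : 'I_n) (x : 'rV[R]_n) :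
  {for x, continuous (fun y : 'rV[R]_n => y ord0 i)}.
Proof. exact: coord_continuous. Qed.

Lemma continuousSum (T : topologicalType) (I : Type) (r : seq I) (P : pred I)
    (f : I -> T -> R) x :
  (forall i, P i -> {for x, continuous (f i)}) ->
  {for x, continuous (fun y => \sum_(i <- r | P i) f i y)}.
Proof.
by move=> fc; apply: cvg_big => //= y; apply: cvgD; [exact: cvg_fst|exact: cvg_snd].
Qed.

Lemma continuousSub (T : topologicalType) (f g : T -> R) x :
  {for x, continuous f} -> {for x, continuous g} -> {for x, continuous (fun y => f y - g y)}.
Proof. by move=> fc gc; apply: cvgB. Qed.

Lemma continuousMul (T : topologicalType) (f g : T -> R) x :
  {for x, continuous f} -> {for x, continuous g} -> {for x, continuous (fun y => f y * g y)}.
Proof. by move=> fc gc; apply: cvgM. Qed.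

Lemma continuousInv (T : topologicalType) (f : T -> R) x : f x != 0 ->
  {for x, continuous f} -> {for x, continuous (fun y => (f y)^-1)}.
Proof. by move=> fx fc; apply: cvgV. Qed.

Lemma continuousCst (T : topologicalType) (c : R) (x : T) :
  {for x, continuous (fun=> c)}.
Proof. exact: cvg_cst. Qed.

Section BigMin.
Variables (T : topologicalType) (m : nat) (f : 'I_m -> T -> R) (a0 : 'I_m).
Implicit Types (A : {set 'I_m}) (x : T).

(** For [a0] in [A] the starting value is itself one of the values compared, so this is the true
    minimum. *)
Definition bmin A x := \big[Order.min/f a0 x]_(i in A) f i x.

Lemma bmin_le A x i : i \in A -> bmin A x <= f i x.
Proof. by move=> iA; rewrite /bmin (bigD1 i) //= ge_min lexx. Qed.

Lemma bmin_attained A x : a0 \in A -> exists2 i, i \in A & bmin A x = f i x.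
Proof.
move=> a0A; rewrite /bmin.
elim/big_rec: _ => [|i y iA [k kA ->]]; first by exists a0.
by rewrite /Order.min; case: ifP => _; [exists i|exists k].
Qed.

Lemma bmin_continuous A x :
  (forall i, {for x, continuous (f i)}) -> {for x, continuous (bmin A)}.
Proof.
move=> fc; rewrite /bmin; elim: (index_enum _) => [|i s IH].
  have -> : (fun y => \big[Order.min/f a0 y]_(i <- [::] | i \in A) f i y) = f a0.
    by apply/funext => y; rewrite big_nil.
  exact: fc.
have -> : (fun y => \big[Order.min/f a0 y]_(i <- i :: s | i \in A) f i y) =
    if i \in A then (f i \min (fun y => \big[Order.min/f a0 y]_(i <- s | i \in A) f i y))%R
    else (fun y => \big[Order.min/f a0 y]_(i <- s | i \in A) f i y).
  by apply/funext => y; rewrite big_cons; case: ifP.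
by case: ifP => _ //; apply: continuous_min => //; exact: fc.
Qed.

End BigMin.

(** Continuity is asked in the ambient space at the points of the subset; this implies continuity
    within the subset and composes directly. *)
Definition top_equiv n m (A : set 'rV[R]_n) (B : set 'rV[R]_m) :=
  exists (f : 'rV[R]_n -> 'rV[R]_m) (g : 'rV[R]_m -> 'rV[R]_n),
    [/\ forall x, A x -> B (f x) /\ g (f x) = x,
        forall y, B y -> A (g y) /\ f (g y) = y,
        forall x, A x -> {for x, continuous f} &
        forall y, B y -> {for y, continuous g}].

Lemma top_equiv_homeomorphic n m (A : set 'rV[R]_n) (B : set 'rV[R]_m) :
  top_equiv A B -> homeomorphic A B.
Proof.
move=> [f [g [fA gB fc gc]]]; exists f, g.
split=> [x /fA[]//|]; split=> [y /gB[]//|]; split=> [x /fA[]//|].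
split=> [y /gB[]//|].
split; apply: continuous_in_subspaceT => x; rewrite inE; [exact: fc|exact: gc].
Qed.

Lemma top_equiv_trans n m k (A : set 'rV[R]_n) (B : set 'rV[R]_m) (C : set 'rV[R]_k) :
  top_equiv A B -> top_equiv B C -> top_equiv A C.
Proof.
move=> [f [g [fA gB fc gc]]] [f' [g' [fB gC fc' gc']]].
exists (f' \o f), (g \o g'); split=> [x Ax|y Cy|x Ax|y Cy] /=.
- have [Bf gf] := fA x Ax; have [Cf gf'] := fB _ Bf.
  by rewrite gf'.
- have [Bf gf] := gC y Cy; have [Cf gf'] := gB _ Bf.
  by rewrite gf'.
- by apply: continuous_comp; [exact: fc | apply: fc'; have [] := fA x Ax].
- by apply: continuous_comp; [exact: gc' | apply: gc; have [] := gC y Cy].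
Qed.

Definition supp n (x : 'rV[R]_n) := [set i : 'I_n | x ord0 i != 0].

Definition geom n (P : {set 'I_n} -> bool) : set 'rV[R]_n :=
  fun x => [/\ forall i, 0 <= x ord0 i, \sum_i x ord0 i = 1 & P (supp x)].

(** * The homeomorphism realising a flip *)

Section Flip.
Variable n : nat.
Implicit Types A B G : {set 'I_n}.

Local Notation coord := (fun i (x : 'rV[R]_n) => x ord0 i).
Let cmin := bmin coord.

(* Moves x along the affine dependence of the simplex A :|: B until one of the
   coordinates indexed by A vanishes. *)
Definition push a0 A B (x : 'rV[R]_n) : 'rV[R]_n :=
  \row_i (x ord0 i - cmin a0 A x * ((i \in A)%:R - #|A|%:R / #|B|%:R * (i \in B)%:R)).

Lemma push_continuous a0 A B x : {for x, continuous (push a0 A B)}.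
Proof.
apply: continuous_rV => j.
have -> : (fun y => push a0 A B y ord0 j) = (fun y : 'rV[R]_n => y ord0 j -
   cmin a0 A y * ((j \in A)%:R - #|A|%:R / #|B|%:R * (j \in B)%:R)).
  by apply/funext => y; rewrite mxE.
apply: continuousSub; first exact: continuous_coord.
apply: continuousMul; last exact: continuousCst.
by apply: bmin_continuous => i; exact: continuous_coord.
Qed.

(** The predicates [P] and [Q] stand for the faces before and after the flip. No support contains
    [B] beforehand, so the minimum over [B] is 0. After the push it is [mA * (#|A|%:R / #|B|%:R)],
    exactly the amount that the reverse push takes back. *)
Lemma push_geom a0 b0 A B (P Q : {set 'I_n} -> bool) : a0 \in A -> b0 \in B ->
  [disjoint A & B] ->
  (forall G, P G -> ~~ (B \subset G)) ->
  (forall G, P G -> A \subset G -> G \subset A :|: B) ->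
  (forall G, P G -> ~~ (A \subset G) -> Q G) ->
  (forall G, G \subset A :|: B -> ~~ (A \subset G) -> Q G) ->
  forall x, geom P x -> geom Q (push a0 A B x) /\ push b0 B A (push a0 A B x) = x.
Proof.
move=> a0A b0B AB PB PA PQ HQ x [x0 x1 Px].
have cA : (#|A|%:R : R) != 0 by rewrite pnatr_eq0 -lt0n; apply/card_gt0P; exists a0.
have cB : (#|B|%:R : R) != 0 by rewrite pnatr_eq0 -lt0n; apply/card_gt0P; exists b0.
set mA := cmin a0 A x.
have mA0 : 0 <= mA by have [i _ e] := bmin_attained coord x a0A; rewrite /mA /cmin e.
have pE i : push a0 A B x ord0 i = x ord0 i - mA * ((i \in A)%:R - #|A|%:R / #|B|%:R * (i \in B)%:R).
  by rewrite mxE.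
have pA i : i \in A -> push a0 A B x ord0 i = x ord0 i - mA.
  by move=> iA; rewrite pE iA (disjointFr AB iA) mulr0 subr0 mulr1.
have pB i : i \in B -> push a0 A B x ord0 i = x ord0 i + mA * (#|A|%:R / #|B|%:R).
  by move=> iB; rewrite pE iB (disjointFl AB iB) sub0r mulr1 mulrN opprK.
have pN i : i \notin A -> i \notin B -> push a0 A B x ord0 i = x ord0 i.
  by move=> /negPf iA /negPf iB; rewrite pE iA iB mulr0 subr0 mulr0 subr0.
split.
  split.
  - move=> i; have [iA|iA] := boolP (i \in A); first by rewrite pA // subr_ge0 bmin_le.
    have [iB|iB] := boolP (i \in B); last by rewrite pN.
    by rewrite pB // addr_ge0 // mulr_ge0 // divr_ge0.
  - under eq_bigr do rewrite pE.
    rewrite sumrB x1 -mulr_sumr sumrB -mulr_sumr.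
    have sE (C : {set 'I_n}) : \sum_i ((i \in C)%:R : R) = #|C|%:R.
      by rewrite -sum1_card natr_sum [RHS]big_mkcond; apply: eq_bigr => i _; case: (i \in C).
    by rewrite !sE divfK // subrr mulr0 subr0.
  - have [i iA eA] := bmin_attained coord x a0A.
    have nA : ~~ (A \subset supp (push a0 A B x)).
      apply/negP => /fintype.subsetP/(_ i iA); rewrite inE pA //.
      by rewrite -[x ord0 i]eA subrr eqxx.
    (* If the minimum over [A] is 0 the point does not move; otherwise its support contains [A] and
       hence lies in [A :|: B]. *)
    have [m0|m0] := eqVneq mA 0.
      have e : push a0 A B x = x by apply/rowP => j; rewrite pE m0 mul0r subr0.
      by rewrite e in nA *; exact: PQ.
    apply: HQ => //; have : A \subset supp x.
      apply/fintype.subsetP => j jA; rewrite inE gt_eqF //.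
      by apply: lt_le_trans (bmin_le coord a0 x jA); rewrite lt_neqAle eq_sym m0.
    move/(PA _ Px)/fintype.subsetP => sx; apply/fintype.subsetP => j; rewrite inE => jx.
    have [jA|jA] := boolP (j \in A); first by rewrite inE jA.
    have [jB|jB] := boolP (j \in B); first by rewrite inE jB orbT.
    by apply: sx; rewrite inE -pN.
have mB : cmin b0 B x = 0.
  have [i iB iS] := fintype.subsetPn (PB _ Px).
  have xi : x ord0 i = 0 by apply/eqP; move: iS; rewrite inE negbK.
  apply/eqP; rewrite eq_le -{1}xi bmin_le //=.
  by have [k _ e] := bmin_attained coord x b0B; rewrite /cmin e.
have mB' : cmin b0 B (push a0 A B x) = mA * (#|A|%:R / #|B|%:R).
  apply/eqP; rewrite eq_le; apply/andP; split.
    have [k kB e] := bmin_attained coord x b0B.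
    have := bmin_le coord b0 (push a0 A B x) kB.
    by rewrite /= pB // -[x ord0 k]e -/cmin mB add0r.
  have [k kB e] := bmin_attained coord (push a0 A B x) b0B.
  by rewrite /cmin e pB // lerDr.
apply/rowP => i; rewrite mxE mB'.
have [iA|iA] := boolP (i \in A).
  rewrite pA // (disjointFr AB iA) sub0r mulr1 mulrN opprK.
  by field; rewrite cA cB.
have [iB|iB] := boolP (i \in B).
  by rewrite pB // mulr0 subr0 mulr1 addrK.
by rewrite pN // mulr0 subr0 mulr0 subr0.
Qed.

End Flip.

(** * The boundary of a simplex as a round sphere *)

Section SimplexBoundary.
Variables (n d : nat) (e : 'I_d.+1 -> 'I_n).
Hypothesis e_inj : injective e.
Let H := [set e k | k : 'I_d.+1].

Let w (j : 'I_d) : 'I_d.+1 := widen_ord (leqnSn d) j.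
(** Appending a zero last coordinate identifies [R^d] with [R^(d+1)] modulo the diagonal. [bary]
    picks the representative with minimum 0 and sum 1; [proj] subtracts the last coordinate and
    normalises the Euclidean length. *)
Let ext (k : 'I_d.+1) (y : 'rV[R]_d) : R := \sum_j y ord0 j * (w j == k)%:R.
Let low (y : 'rV[R]_d) := bmin ext ord_max [set: 'I_d.+1] y.
Let mass (y : 'rV[R]_d) := \sum_k (ext k y - low y).
Let bary (y : 'rV[R]_d) : 'rV[R]_n := \row_i \sum_k (e k == i)%:R * ((ext k y - low y) / mass y).
Let dif (j : 'I_d) (x : 'rV[R]_n) : R := x ord0 (e (w j)) - x ord0 (e ord_max).
Let rad (x : 'rV[R]_n) : R := Num.sqrt (\sum_j dif j x * dif j x).
Let proj (x : 'rV[R]_n) : 'rV[R]_d := \row_j (dif j x / rad x).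

Let wmax j : (w j == ord_max) = false.
Proof. by apply/negbTE; rewrite -val_eqE /= neq_ltn ltn_ord. Qed.

Let ext_w j y : ext (w j) y = y ord0 j.
Proof.
rewrite /ext (bigD1 j) //= eqxx mulr1 big1 ?addr0 // => i nij.
by rewrite -val_eqE /= val_eqE (negPf nij) mulr0.
Qed.

Let ext_max y : ext ord_max y = 0.
Proof. by rewrite /ext big1 // => j _; rewrite wmax mulr0. Qed.

Let ordP (k : 'I_d.+1) : (exists j, k = w j) \/ k = ord_max.
Proof.
case: (ltnP k d) => kd; first by left; exists (Ordinal kd); apply: val_inj.
by right; apply: val_inj => /=; apply/eqP; rewrite eqn_leq kd -ltnS ltn_ord.
Qed.

Let bary_e y k : bary y ord0 (e k) = (ext k y - low y) / mass y.
Proof.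
rewrite mxE (bigD1 k) //= eqxx mul1r big1 ?addr0 // => i nik.
by rewrite (inj_eq e_inj) (negPf nik) mul0r.
Qed.

Let bary_out y i : i \notin H -> bary y ord0 i = 0.
Proof.
move=> iH; rewrite mxE big1 // => k _; case: eqP => [ek|_]; last by rewrite mul0r.
by case/negP: iH; rewrite -ek; apply/imsetP; exists k.
Qed.

Let sum_e (x : 'rV[R]_n) : (forall i, i \notin H -> x ord0 i = 0) ->
  \sum_i x ord0 i = \sum_k x ord0 (e k).
Proof.
move=> xo.
have -> : \sum_k x ord0 (e k) = \sum_k \sum_i (e k == i)%:R * x ord0 i.
  apply: eq_bigr => k _; rewrite (bigD1 (e k)) //= eqxx mul1r big1 ?addr0 // => i nik.
  by rewrite eq_sym (negPf nik) mul0r.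
rewrite exchange_big /=; apply: eq_bigr => i _.
have [/imsetP[k _ ->]|iH] := boolP (i \in H); last first.
  by rewrite xo // big1 // => k _; rewrite mulr0.
rewrite (bigD1 k) //= eqxx mul1r big1 ?addr0 // => l nlk.
by rewrite (inj_eq e_inj) (negPf nlk) mul0r.
Qed.

Let low_le y k : low y <= ext k y.
Proof. by apply: bmin_le; rewrite inE. Qed.

Let mass_gt0 y : @unit_sphere R d y -> 0 < mass y.
Proof.
move=> y1; have m0 : 0 <= mass y by apply: sumr_ge0 => k _; rewrite subr_ge0.
rewrite lt_neqAle m0 andbT eq_sym; apply/eqP => /eqP.
rewrite psumr_eq0; last by move=> k _; rewrite subr_ge0.
move=> /allP z; have zE k : ext k y = low y.
  by apply/eqP; rewrite -subr_eq0; apply: z; rewrite mem_index_enum.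
have : \sum_i y ord0 i ^+ 2 = 0.
  by apply: big1 => j _; rewrite -ext_w zE -(zE ord_max) ext_max expr0n.
by rewrite y1 => /eqP; rewrite oner_eq0.
Qed.

(** With zero radius all coordinates on [H] agree, and one of them vanishes on the boundary, so
    their sum could not be 1. *)
Let rad_gt0 x : geom (face (ridges H)) x -> 0 < rad x.
Proof.
move=> [x0 x1 /faceP[_ /ridgesP[_ /imsetP[k0 _ ->] ->] sx]].
have xo i : i \notin H -> x ord0 i = 0.
  move=> iH; apply/eqP; apply: contraNT iH => xi.
  by have := fintype.subsetP sx i; rewrite !inE xi => /(_ isT)/andP[].
have xk0 : x ord0 (e k0) = 0.
  apply/eqP/negPn/negP => xi.
  by have := fintype.subsetP sx (e k0); rewrite !inE xi eqxx => /(_ isT).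
rewrite /rad sqrtr_gt0 lt_neqAle sumr_ge0 ?andbT; last by move=> j _; rewrite -expr2 sqr_ge0.
rewrite eq_sym; apply/eqP => /eqP.
rewrite psumr_eq0; last by move=> j _; rewrite -expr2 sqr_ge0.
move=> /allP z; have zE j : x ord0 (e (w j)) = x ord0 (e ord_max).
  apply/eqP; rewrite -subr_eq0 -/(dif j x) -[_ == 0]orbb -mulf_eq0; apply: z.
  by rewrite mem_index_enum.
have xm : x ord0 (e ord_max) = 0.
  by rewrite -xk0; case: (ordP k0) => [[j ->]|->] //; rewrite zE.
have : \sum_i x ord0 i = 0.
  rewrite sum_e // big1 // => k _.
  by case: (ordP k) => [[j ->]|->]; rewrite ?zE.
by rewrite x1 => /eqP; rewrite oner_eq0.
Qed.

Lemma simplex_boundary_equiv : top_equiv (geom (face (ridges H))) (@unit_sphere R d).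
Proof.
have ext_cont k y : {for y, continuous (ext k)}.
  apply: continuousSum => j _; apply: continuousMul; first exact: continuous_coord.
  exact: continuousCst.
have low_cont y : {for y, continuous low} by apply: bmin_continuous => k.
have dif_cont j x : {for x, continuous (dif j)}.
  by apply: continuousSub; exact: continuous_coord.
exists proj, bary; split.
- move=> x gx; have r0 := rad_gt0 gx; have rn0 := lt0r_neq0 r0.
  have [x0 x1 /faceP[_ /ridgesP[_ /imsetP[k0 _ ->] ->] sx]] := gx.
  have xo i : i \notin H -> x ord0 i = 0.
    move=> iH; apply/eqP; apply: contraNT iH => xi.
    by have := fintype.subsetP sx i; rewrite !inE xi => /(_ isT)/andP[].
  have xk0 : x ord0 (e k0) = 0.
    apply/eqP/negPn/negP => xi.
    by have := fintype.subsetP sx (e k0); rewrite !inE xi eqxx => /(_ isT).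
  split.
    rewrite /unit_sphere /=; under eq_bigr do rewrite mxE expr_div_n.
    rewrite -mulr_suml sqr_sqrtr; last by apply: sumr_ge0 => j _; rewrite -expr2 sqr_ge0.
    under eq_bigr do rewrite expr2.
    rewrite divff //; apply: contraNneq rn0 => z; by rewrite /rad z sqrtr0.
  have extE k : ext k (proj x) = (x ord0 (e k) - x ord0 (e ord_max)) / rad x.
    by case: (ordP k) => [[j ->]|->]; rewrite ?ext_w ?mxE // ext_max subrr mul0r.
  (* The minimum is attained at [k0], the vertex opposite a facet containing the support, where [x]
     vanishes. *)
  have lowE : low (proj x) = - x ord0 (e ord_max) / rad x.
    apply/eqP; rewrite eq_le; apply/andP; split.
      by have := low_le (proj x) k0; rewrite extE xk0 sub0r.
    have [k _ le] := @bmin_attained _ _ ext ord_max [set: 'I_d.+1] (proj x) (finset.in_setT _).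
    rewrite /low le extE ler_pM2r ?invr_gt0 // lerBrDr addrC subrr; exact: x0.
  have difE k : ext k (proj x) - low (proj x) = x ord0 (e k) / rad x.
    by rewrite extE lowE -mulrBl opprK subrK.
  have massE : mass (proj x) = (rad x)^-1.
    rewrite /mass; under eq_bigr do rewrite difE.
    by rewrite -mulr_suml -sum_e // x1 mul1r.
  apply/rowP => i; have [/imsetP[k _ ->]|iH] := boolP (i \in H); last first.
    by rewrite bary_out // xo.
  by rewrite bary_e difE massE invrK mulfVK.
- move=> y sy; have S0 := mass_gt0 sy; have Sn0 := lt0r_neq0 S0; split.
    split.
    + move=> i; have [/imsetP[k _ ->]|iH] := boolP (i \in H); last by rewrite bary_out.
      by rewrite bary_e divr_ge0 ?subr_ge0 // ltW.
    + rewrite sum_e; last by move=> i; exact: bary_out.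
      under eq_bigr do rewrite bary_e.
      by rewrite -mulr_suml divff.
    + have [k _ le] := @bmin_attained _ _ ext ord_max [set: 'I_d.+1] y (finset.in_setT _).
      apply/faceP; exists (H :\ e k).
        by apply/ridgesP; exists (e k) => //; apply/imsetP; exists k.
      apply/fintype.subsetP => i; rewrite !inE => ni; apply/andP; split.
        by apply: contraNneq ni => ->; rewrite bary_e /low le subrr mul0r.
      by apply: contraNT ni => iH; rewrite bary_out.
  have difE j : dif j (bary y) = y ord0 j / mass y.
    by rewrite /dif !bary_e -mulrBl ext_w ext_max sub0r opprK subrK.
  have radE : rad (bary y) = (mass y)^-1.
    rewrite /rad; have -> : \sum_j dif j (bary y) * dif j (bary y) = (mass y)^-1 ^+ 2.
      under eq_bigr do rewrite difE -expr2 expr_div_n.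
      by rewrite -mulr_suml sy mul1r exprVn.
    by rewrite sqrtr_sqr ger0_norm // invr_ge0 ltW.
  by apply/rowP => j; rewrite mxE difE radE invrK mulfVK.
- move=> x gx; have r0 := lt0r_neq0 (rad_gt0 gx).
  apply: continuous_rV => j.
  have -> : (fun y => proj y ord0 j) = (fun y => dif j y * (rad y)^-1).
    by apply/funext => y; rewrite mxE.
  apply: continuousMul => //; apply: continuousInv => //.
  apply: continuous_comp; last exact: sqrt_continuous.
  by apply: continuousSum => i _; apply: continuousMul.
- move=> y sy; have S0 := lt0r_neq0 (mass_gt0 sy).
  apply: continuous_rV => i.
  have -> : (fun y => bary y ord0 i) =
      (fun y => \sum_k (e k == i)%:R * ((ext k y - low y) * (mass y)^-1)).
    by apply/funext => z; rewrite mxE.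
  apply: continuousSum => k _; apply: continuousMul; first exact: continuousCst.
  apply: continuousMul; first exact: continuousSub.
  by apply: continuousInv => //; apply: continuousSum => l _; exact: continuousSub.
Qed.

End SimplexBoundary.

(** Each flip contributes a [push], with inverse obtained by exchanging [A] and [B]; composing them
    leads back to the boundary of a simplex. *)
Theorem flip_sphere_equiv n d (Phi : {set {set 'I_n}}) :
  flip_sphere d Phi -> top_equiv (geom (face Phi)) (@unit_sphere R d).
Proof.
elim=> [H cH|{}Phi A B sPhi IH AB cAB A0 B0 oldP newB].
  pose e (k : 'I_d.+1) := enum_val (cast_ord (esym cH) k).
  have e_inj : injective e by move=> k l /enum_val_inj/cast_ord_inj.
  have -> : H = [set e k | k : 'I_d.+1].
    apply/eqP; rewrite eq_sym eqEcard card_imset // card_ord cH leqnn andbT.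
    by apply/fintype.subsetP => _ /imsetP[k _ ->]; exact: enum_valP.
  exact: simplex_boundary_equiv.
have nPhi := flip_sphere_npm sPhi.
apply: top_equiv_trans IH.
have fE G := face_flip nPhi AB cAB B0 oldP G.
have /set0Pn[a0 a0A] := A0; have /set0Pn[b0 b0B] := B0.
have BN G : face Phi G -> ~~ (B \subset G).
  move=> /faceP[F FP GF]; apply: contra newB => BG; apply/faceP; exists F => //.
  exact: fintype.subset_trans BG GF.
have AN (G : {set _}) : face Phi G -> A \subset G -> G \subset A :|: B.
  move=> /faceP[F FP GF] AG.
  have [b bB eF] := star_flip nPhi AB cAB B0 oldP FP (fintype.subset_trans AG GF).
  by apply: fintype.subset_trans GF _; rewrite eF subD1set.
have old (G : {set _}) : G \subset A :|: B -> ~~ (B \subset G) -> face Phi G.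
  move=> GH /fintype.subsetPn[b bB bG]; apply/faceP; exists ((A :|: B) :\ b); first exact: oldP.
  apply/fintype.subsetP => x xG; rewrite in_setD1 (fintype.subsetP GH) // andbT.
  by apply: contraNneq bG => <-.
have h1 := @push_geom n a0 b0 A B (face Phi) (face (flip Phi A B)) a0A b0B AB BN AN.
have BA : [disjoint B & A] by rewrite disjoint_sym.
have h2 := @push_geom n b0 a0 B A (face (flip Phi A B)) (face Phi) b0B a0A BA.
exists (push b0 B A), (push a0 A B); split.
- apply: h2 => G; rewrite ?fE.
  + by move=> /andP[].
  + move=> /andP[/orP[/BN/negPf->//|]]; by rewrite finset.setUC.
  + by move=> /andP[/orP[//|/old]].
  + by rewrite finset.setUC; exact: old.
- by apply: h1 => G; rewrite fE => -> ->; rewrite ?orbT.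
- by move=> x _; exact: push_continuous.
- by move=> x _; exact: push_continuous.
Qed.

End Topology.

(** * Counting *)

Section Final.
Variable R : realType.

Definition complex n (Phi : {set {set 'I_n}}) : {set {set 'I_n}} := [set G | face Phi G].

Lemma complex_sphere n d (Phi : {set {set 'I_n}}) : flip_sphere d Phi ->
  face Phi finset.set0 -> @simplicial_sphere R d n (complex Phi).
Proof.
move=> sPhi f0; split.
  split=> [|F G]; rewrite !inE // => /faceP[K KP FK] GF; apply/faceP; exists K => //.
  exact: fintype.subset_trans GF FK.
have -> : @geom_realization R n (complex Phi) = geom (face Phi).
  apply/funext => x; apply/propext; rewrite /geom_realization /geom /=.
  by split=> [[x0 [x1 xs]]|[x0 x1 xs]]; split => //; [move: xs | split => //];
    rewrite inE.
exact/top_equiv_homeomorphic/flip_sphere_equiv.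
Qed.

(** The faces [test F] let [X] be read off from its sphere, so different subsets of [L] give
    different spheres. *)
Lemma sn_ge n d (L : {set {set 'I_n}}) (Phi : {set {set 'I_n}} -> {set {set 'I_n}})
    (test : {set 'I_n} -> {set 'I_n}) :
  (forall X : {set {set 'I_n}}, X \subset L -> flip_sphere d (Phi X)) ->
  (forall (X : {set {set 'I_n}}) (K : {set 'I_n}), X \subset L -> (#|K| <= d./2)%N -> face (Phi X) K) ->
  (forall (X : {set {set 'I_n}}) F, X \subset L -> F \in L -> face (Phi X) (test F) = (F \in X)) ->
  (2 ^ #|L| <= sn R d n)%N.
Proof.
move=> sPhi nPhi tPhi; rewrite -card_powerset.
rewrite -(@card_in_imset _ _ (fun X => complex (Phi X)) (powerset L)); last first.
  move=> X Y; rewrite !powersetE => XL YL e; apply/finset.setP => F.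
  have [FL|FL] := boolP (F \in L).
    rewrite -(tPhi X) // -(tPhi Y) //.
    by have := congr1 (fun K : {set {set 'I_n}} => test F \in K) e; rewrite !inE.
  by apply/idP/idP => h; move: FL; rewrite (fintype.subsetP _ _ h).
apply/fintype.subset_leq_card/fintype.subsetP => K /imsetP[X].
rewrite powersetE => XL ->; rewrite inE; apply/asboolP; split.
  by apply: complex_sphere; [exact: sPhi | apply: nPhi; rewrite ?cards0].
by move=> F cF; rewrite inE; exact: nPhi.
Qed.

Lemma sn_ge_odd n m h : (0 < m)%N -> (m.*2 <= n)%N -> (h.*2.+2 <= n)%N ->
  exists2 l, (2 ^ l <= sn R m.*2.-1 n)%N & ('C(h, m) <= l * (n.+1 * m.*2).+1)%N.
Proof.
move=> m0 mn hn; have [s sL] := big_level m hn (leqnn n).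
exists #|level n m n s| => //.
pose J X := [set G : {set 'I_n} | cell m 0 n G & nmem G 0] :|: over m n s X.
have sph (X : {set {set 'I_n}}) : X \subset level n m n s -> flip_sphere m.*2.-1 (bdry m.*2.-1 (J X)) /\
    forall K : {set 'I_n}, (#|K| <= m.-1)%N -> face (bdry m.*2.-1 (J X)) K.
  move=> XL; apply: squeezed_sphere => //; first exact: lower_overz.
  by move=> F cF F0; rewrite !inE cF F0.
apply: (@sn_ge _ _ _ (fun X => bdry m.*2.-1 (J X)) (@tops n)).
- by move=> X /sph[].
- move=> X K /sph[_ f] cK; apply: f; apply: leq_trans cK _.
  by case: (m) m0 => // m' _; rewrite doubleS /= uphalf_double.
- move=> X F XL FL; have := FL; rewrite inE => /and3P[cF F0 _].
  rewrite (@squeezed_face n m) //; last 2 first.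
  + exact: lower_overz.
  + move=> G; rewrite finset.in_setU inE => /orP[/andP[_ G0]|GJ FG]; last exact: over_max XL FL GJ FG.
    by move=> /(_ 1%N); rewrite !cntS !cnt0 G0 (negPf F0).
  by rewrite finset.in_setU inE (negPf F0) andbF /= over_level.
Qed.

(** The cells chosen use [n] vertices; the two further ones are needed for the translates and for
    [w]. *)
Lemma sn_ge_even n m h : (0 < m)%N -> (m.*2 <= n)%N -> (h.*2.+2 <= n)%N ->
  exists2 l, (2 ^ l <= sn R m.*2 n.+2)%N & ('C(h, m) <= l * (n.+3 * m.*2).+1)%N.
Proof.
move=> m0 mn hn; have nn : (n <= n.+2)%N by rewrite ltnW.
have [s sL] := big_level m hn nn.
exists #|level n.+2 m n s| => //.
apply: (@sn_ge _ _ _ (fun X => bdry m.*2 (sewn m (shadow m (over m n s X)))) id).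
- by move=> X XL; case: (sewn_shadow m0 mn (lower_over XL)).
- move=> X K XL; rewrite doubleK; case: (sewn_shadow m0 mn (lower_over XL)) => _; exact.
- move=> X F XL FL; have := FL; rewrite inE => /and3P[cF F0 /eqP wF].
  rewrite (shadow_facet m0 mn (lower_over XL) cF).
  + exact: over_level.
  + by rewrite -nmemE.
  + move=> G cG GF nGF; have [le e] := below_wgt GF.
    have lt : (wgt F < wgt G)%N by rewrite ltn_neqAle le andbT e nGF.
    by rewrite !inE cG -wF lt.
Qed.

End Final.

(** The falling factorial of [h] has [m] factors, each at least [h - m], and [h - m] is at least
    [n / 8]. *)
Lemma binomial_growth n m h : (8 * m + 32 <= n)%N -> (n <= h.*2 + 6)%N ->
  (n ^ m <= 8 ^ m * m`! * 'C(h, m))%N.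
Proof.
move=> nm nh; rewrite -mulnA (mulnC m`!) bin_ffact ffact_prod.
have mh : (n <= 8 * (h - m))%N by move: nm nh; clear; lia.
apply: leq_trans (_ : (8 ^ m * (h - m) ^ m <= _)%N); last first.
  rewrite leq_pmul2l ?expn_gt0 // -{2}(card_ord m) -prod_nat_const.
  by apply: leq_prod => i _; apply: leq_sub2l; exact: ltnW.
rewrite -expnMn; case: (m) mh => [|m'] mh //.
by rewrite leq_exp2r.
Qed.

Lemma sn_lower (R : realType) (d : nat) : (0 < d)%N -> exists K n0 : nat, (0 < K)%N /\
  forall n, (n0 <= n)%N -> exists2 l, (2 ^ l <= sn R d n)%N & (n ^ d.-1./2 <= K * l)%N.
Proof.
move=> d0; set m := d.+1./2.
have m0 : (0 < m)%N by rewrite /m; case: (d) d0 => // d' _.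
have eE : d.-1./2 = m.-1 by rewrite /m; case: (d) d0.
(* The factor [5 * m] comes from bounding the number of weights, [(n.+1 * m.*2).+1], by [5 * m * n];
   the other factors come from [binomial_growth]. *)
exists (8 ^ m * m`! * (5 * m))%N, (8 * m + 32)%N.
split; first by rewrite !muln_gt0 expn_gt0 fact_gt0 m0.
(* In the even case only [n - 2] vertices carry the chosen cells, and [dbl] leaves two more free,
   whence the 4. *)
move=> n nm; set h := (n - 4)./2.
have [l sl cl] : exists2 l, (2 ^ l <= sn R d n)%N & ('C(h, m) <= l * (n.+1 * m.*2).+1)%N.
  case od : (odd d).
    have -> : d = m.*2.-1 by rewrite /m; move: od; clear; lia.
    apply: sn_ge_odd => //.
      by move: nm; clear; lia.
    by rewrite /h; move: nm; clear; lia.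
  have -> : d = m.*2 by rewrite /m; move: od; clear; lia.
  have -> : n = n.-2.+2 by move: nm; clear; lia.
  apply: sn_ge_even => //.
    by move: nm; clear; lia.
  by rewrite /h; move: nm; clear; lia.
exists l => //; rewrite eE.
have := @binomial_growth n m h nm; have nh : (n <= h.*2 + 6)%N by rewrite /h; clear; lia.
move=> /(_ nh) g.
have n0 : (0 < n)%N by move: nm; clear; lia.
(* Spreading the cells over linearly many weights costs one factor [n], so the exponent drops from
   [m] to [m.-1]. *)
rewrite -(leq_pmul2r n0) -expnSr prednK //; apply: leq_trans g _.
rewrite -!mulnA leq_pmul2l ?expn_gt0 // leq_pmul2l ?fact_gt0 //.
apply: leq_trans cl _; rewrite [X in (_ <= X)%N](_ : _ = l * (5 * (m * n)))%N; last first.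
  by clear; lia.
rewrite leq_mul2l; apply/orP; right; move: nm m0; clear; nia.
Qed.

Theorem theorem1p2 (R : realType) (d : nat) (hd : (5 <= d)%N) :
  exists (c : R) (n0 : nat), 0 < c /\
    forall n : nat, (n0 <= n)%N ->
      (2 : R) `^ (c * (n%:R) ^+ (d.-1)./2) <= (sn R d n)%:R.
Proof.
have [|K [n0 [K0 lower]]] := @sn_lower R d; first exact: leq_trans hd.
exists (K%:R^-1), n0; split => [|n nn0]; first by rewrite invr_gt0 ltr0n.
have [l sl nl] := lower n nn0.
apply: (@le_trans _ _ ((2 : R) `^ l%:R)).
  rewrite ler_powR ?ler1n // ler_pdivrMl ?ltr0n //.
  by rewrite -natrX -natrM ler_nat.
by rewrite powR_mulrn // -natrX ler_nat.
Qed.
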